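(* Assume the Hardy--Littlewood conjecture (HL). Let $\alpha$ be a positive odd integer with $\alpha\equiv(-1)^\rho\ (\mathrm{mod}\ 4)$, $\rho\in\{0,1\}$; let $\beta\in\{1,i\}$, $r\in\mathbb{Z}\setminus\{0\}$, $0\leqslant d\leqslant3$, and $\boldsymbol\gamma=(\gamma_1,\gamma_2)$ with integers $0\leqslant\gamma_1,\gamma_2\leqslant7$, $\gamma_1\equiv\gamma_2\ (\mathrm{mod}\ 2)$. Then as $x\to+\infty$, $$\mathcal{G}_d(x;r,\alpha,\beta,\boldsymbol\gamma)\sim\frac{h_{1,r}}{16}\cdot\Delta_G(r,\beta,\boldsymbol\gamma)\cdot G_d(r,\alpha,\beta,\boldsymbol\gamma)\cdot\frac{\sqrt x}{\log x},$$ where $$\Delta_G(r,\beta,\boldsymbol\gamma)=\begin{cases}1,& r\equiv4\gamma_1+2\ (\mathrm{mod}\ 32)\text{ and }\beta=1,\\ 1,& r\equiv-4\gamma_2\ (\mathrm{mod}\ 32)\text{ and }\beta=i,\\ 0,&\text{otherwise,}\end{cases}$$ $$G_d(r,\alpha,\beta,\boldsymbol\gamma)=1+2\Re(i^d)(-1)^{\rho\gamma_2}\Big(\frac{i\beta}{\alpha}\Big)_4\Omega_4(1;\alpha,r)+(-1)^d\,\Omega_2(1;\alpha,r).$$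
   Context: $\Pi_1(x)$ is the set of $\pi\in\mathbb{Z}[i]$ whose norm $N(\pi)=\pi\bar\pi$ is a rational prime $\leqslant x$, and $$\mathcal{G}_d(x;r,\alpha,\beta,\boldsymbol\gamma)=\Big|\Big\{\pi\in\Pi_1(x):\ \mathrm{Tr}(\beta\pi)=r,\ \Big(\frac{\alpha}{\pi}\Big)_4=i^d,\ \pi\equiv2\gamma_1+1+2\gamma_2i\ (\mathrm{mod}\ 16)\Big\}\Big|.$$ Quartic residue symbol: for a prime $\pi\in\mathbb{Z}[i]$ coprime to $2$, $(\frac{z}{\pi})_4\in\{0,\pm1,\pm i\}$ with $(\frac{z}{\pi})_4\equiv z^{(N(\pi)-1)/4}\ (\mathrm{mod}\ \pi)$; it is extended multiplicatively in the denominator to all elements of $\mathbb{Z}[i]$ coprime to $2$. $\Omega_j(1;q,r)=\prod_{p^\nu\parallel q,\ p\nmid r,\ j\nmid\nu}\frac{-1}{p-1-(\frac{-1}{p})}$ (product over rational primes $p\mid q$, empty product $=1$). $h_{1,r}=\prod_{p\nmid2r}\big(1-\frac{(\frac{-1}{p})}{p-1}\big)$ if $2\mid r$, and $h_{1,r}=0$ if $2\nmid r$ (products over primes in increasing order). If the constant is $0$, the asymptotic formula means the left side is $O(1)$. (HL): for all $a,b,c\in\mathbb{Z}$ with $a>0$, $b^2-4ac$ not a square, $\gcd(a,b,c)=1$, and $a+b$, $c$ not both even, the number $\pi_{a,b,c}(x)$ of primes $p\leqslant x$ of the form $am^2+bm+c$, $m\in\mathbb{Z}_{\geqslant1}$,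 satisfies $\pi_{a,b,c}(x)\sim\frac{\gcd(2,a+b)}{\sqrt a}\frac{\Delta}{\varphi(\Delta)}\prod_{p\nmid2a}\Big(1-\frac{(\frac{b^2-4ac}{p})}{p-1}\Big)\frac{\sqrt x}{\log x}$, $\Delta$ being the odd part of $\gcd(a,b)$. *)

(* Defs.v *)
From HB Require Import structures.
From mathcomp Require Import all_boot all_order all_algebra.
From mathcomp Require Import finmap ring complex.
From mathcomp Require Import all_classical all_reals all_analysis.

Set Implicit Arguments.
Unset Strict Implicit.
Unset Printing Implicit Defensive.

Import Order.TTheory GRing.Theory Num.Theory.
Import numFieldNormedType.Exports.

Local Open Scope classical_set_scope.
Local Open Scope complex_scope.
Local Open Scope ring_scope.

Record gint : Type := Gint { gre : int; gim : int }.

Definition pair_of_gint (z : gint) : int * int := (gre z, gim z).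
Definition gint_of_pair (p : int * int) : gint := Gint p.1 p.2.
Lemma pair_of_gintK : cancel pair_of_gint gint_of_pair. Proof. by case. Qed.

HB.instance Definition _ := Countable.copy gint (can_type pair_of_gintK).

Definition gint_add (z w : gint) := Gint (gre z + gre w) (gim z + gim w).
Definition gint_opp (z : gint) := Gint (- gre z) (- gim z).
Definition gint_mul (z w : gint) :=
  Gint (gre z * gre w - gim z * gim w) (gre z * gim w + gim z * gre w).

Lemma gint_addA : associative gint_add.
Proof. by move=> [a b] [c d] [e f]; rewrite /gint_add /= !addrA. Qed.
Lemma gint_addC : commutative gint_add.
Proof. by move=> z w; rewrite /gint_add addrC (addrC (gim z)). Qed.
Lemma gint_add0 : left_id (Gint 0 0) gint_add.
Proof. by move=> [a b]; rewrite /gint_add /= !add0r. Qed.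
Lemma gint_addN : left_inverse (Gint 0 0) gint_opp gint_add.
Proof. by move=> [a b]; rewrite /gint_add /= !addNr. Qed.

HB.instance Definition _ :=
  GRing.isZmodule.Build gint gint_addA gint_addC gint_add0 gint_addN.

Lemma gint_mulA : associative gint_mul.
Proof. by move=> [a b] [c d] [e f]; congr Gint => /=; ring. Qed.
Lemma gint_mulC : commutative gint_mul.
Proof. by move=> [a b] [c d]; congr Gint => /=; ring. Qed.
Lemma gint_mul1 : left_id (Gint 1 0) gint_mul.
Proof. by move=> [a b]; congr Gint => /=; ring. Qed.
Lemma gint_mulDl : left_distributive gint_mul gint_add.
Proof. by move=> [a b] [c d] [e f]; congr Gint => /=; ring. Qed.
Lemma gint_oner_neq0 : Gint 1 0 != Gint 0 0. Proof. by []. Qed.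

HB.instance Definition _ :=
  GRing.Zmodule_isComNzRing.Build gint
    gint_mulA gint_mulC gint_mul1 gint_mulDl gint_oner_neq0.

Definition gi : gint := Gint 0 1.
Definition gconj (z : gint) : gint := Gint (gre z) (- gim z).

(* [z * gconj z] and [z + gconj z] have zero imaginary coordinate, and the
   first one has a nonnegative real coordinate. *)
Definition gint_norm (z : gint) : nat := `|gre (z * gconj z)%R|%N.
Definition gint_trace (z : gint) : int := gre (z + gconj z).

Definition gdvd (w z : gint) : Prop := exists q : gint, z = q * w.
Definition gcong (m z w : gint) : Prop := gdvd m (z - w).
Definition gunit (u : gint) : Prop := gdvd u 1.
Definition gcoprime (z w : gint) : Prop :=
  forall d : gint, gdvd d z -> gdvd d w -> gunit d.
Definition gprime (pi : gint) : Prop :=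
  [/\ pi <> 0, ~ gunit pi &
      forall z w : gint, gdvd pi (z * w) -> gdvd pi z \/ gdvd pi w].

(* [pi] is meant to be a prime coprime to 2; then the five candidate values
   are pairwise incongruent modulo [pi]. *)
Definition quartic_prime (z pi : gint) : gint :=
  xget 0 [set s : gint | s \in [:: 0; 1; -1; gi; - gi] /\
                         gcong pi s (z ^+ ((gint_norm pi).-1 %/ 4))].

(* The multiplicative extension to denominators [w] coprime to 2, through any
   factorization of [w] into primes; the value is 1 when [w] is a unit, and the
   irrelevant 0 when [w] is not coprime to 2. *)
Definition quartic (z w : gint) : gint :=
  xget 0 [set s : gint | exists (u : gint) (ps : seq gint),
    [/\ gunit u,
        forall pi, pi \in ps -> gprime pi /\ gcoprime pi 2%:R,
        w = u * \prod_(pi <- ps) pi &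
        s = \prod_(pi <- ps) quartic_prime z pi]].

Definition gintC (R : realType) (z : gint) : R[i] :=
  (gre z)%:~R +i* (gim z)%:~R.

(* [p] is meant to be an odd prime. *)
Definition legendre (D : int) (p : nat) : int :=
  if (p%:Z %| D)%Z then 0
  else if [exists b : 'I_p, (D == (b : nat)%:Z ^+ 2 %[mod p%:Z])%Z] then 1
  else -1.

(* The product over the primes not dividing [m] converges only conditionally,
   hence the limit of partial products in increasing order. *)
Definition prime_product (R : realType) (D : int) (m : nat) : R :=
  lim ((\prod_(0 <= p < n | prime p && ~~ (p %| m)%N)
         (1 - (legendre D p)%:~R / (p%:R - 1) : R)) @[n --> \oo]).

Definition h1 (R : realType) (r : int) : R :=
  if (2 %| r)%Z then prime_product R (-1) (2 * `|r|)%N else 0.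

(* The quantity Omega_j(1; q, r). *)
Definition Omega1 (R : realType) (j q : nat) (r : int) : R :=
  \prod_(p <- primes q | ~~ (p %| `|r|)%N && ~~ (j %| logn p q)%N)
    (-1 / (p%:R - 1 - (legendre (-1) p)%:~R)).

(* [F x ~ c * G x] as [x] tends to infinity, read as [F x = O(1)] when the
   constant [c] is 0.  It is used for [K = R], and for [K = R[i]] when [c] is
   given by a complex expression. *)
Definition asymp (R : realType) (K : numFieldType)
    (F : R -> K) (c : K) (G : R -> K) : Prop :=
  if c == 0 then exists M : K, \forall x \near +oo, `|F x| <= M
  else (F x / (c * G x) : K^o) @[x --> +oo] --> (1 : K^o).

Definition quadratic_primes (R : realType) (a b c : int) (x : R) : set nat :=
  [set p : nat | [/\ prime p, p%:R <= x &
     exists2 m : nat, (0 < m)%N & p%:Z = a * m%:Z ^+ 2 + b * m%:Z + c]].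

(* [fset_set] sends an infinite set to the empty one, but the sets counted here
   and below are finite. *)
Definition quadratic_prime_count (R : realType) (a b c : int) (x : R) : nat :=
  #|` fset_set (quadratic_primes a b c x)|%fset.

Definition hardy_littlewood (R : realType) : Prop :=
  forall a b c : int,
    0 < a ->
    ~ (exists k : int, b ^+ 2 - 4 * a * c = k ^+ 2) ->
    gcdz (gcdz a b) c = 1 ->
    ~~ ((2 %| a + b)%Z && (2 %| c)%Z) ->
    let Delta := ((`|gcdz a b|)`_2^')%N in
    asymp (fun x : R => (quadratic_prime_count a b c x)%:R)
      ((gcdz 2 (a + b))%:~R / Num.sqrt a%:~R
       * (Delta%:R / (totient Delta)%:R)
       * prime_product R (b ^+ 2 - 4 * a * c) (2 * `|a|)%N)
      (fun x : R => Num.sqrt x / ln x).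

Definition Pi1 (R : realType) (x : R) : set gint :=
  [set pi : gint | prime (gint_norm pi) /\ (gint_norm pi)%:R <= x].

Definition G_set (R : realType) (d : nat) (r : int) (alpha beta : gint)
    (gamma1 gamma2 : nat) (x : R) : set gint :=
  [set pi : gint |
     [/\ Pi1 x pi,
         gint_trace (beta * pi) = r,
         quartic alpha pi = gi ^+ d &
         gcong 16%:R pi (2 * gamma1%:R + 1 + 2 * gamma2%:R * gi)]].

Definition G_count (R : realType) (d : nat) (r : int) (alpha beta : gint)
    (gamma1 gamma2 : nat) (x : R) : nat :=
  #|` fset_set (G_set d r alpha beta gamma1 gamma2 x)|%fset.

Definition Delta_G (r : int) (beta : gint) (gamma1 gamma2 : nat) : nat :=
  if (r == 4 * gamma1%:Z + 2 %[mod 32])%Z && (beta == 1) then 1%N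
  else if (r == - (4 * gamma2%:Z) %[mod 32])%Z && (beta == gi) then 1%N
  else 0%N.

Definition G_const (R : realType) (d : nat) (r : int) (alpha : nat)
    (rho : nat) (beta : gint) (gamma2 : nat) : R[i] :=
  1 + 2 * (gre (gi ^+ d))%:~R * (-1) ^+ (rho * gamma2)
        * gintC R (quartic (gi * beta) alpha%:R) * (Omega1 R 4 alpha r)%:C
    + (-1) ^+ d * (Omega1 R 2 alpha r)%:C.

(* Main.v *)
(* The trace condition and the congruence modulo 16 force pi = u (s + n i), where
   r = 2 s, u is a unit depending on beta, and n runs over a residue class modulo
   16; N(pi) = n^2 + s^2.  For an odd rational prime q let X_q be the quartic
   symbol with denominator q.  Quartic reciprocity for a rational argument,
   (q^* / pi)_4 = X_q(pi) with q^* = +-q = 1 mod 4, is obtained from Gauss sums: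
   in an algebraically closed field of characteristic q, the Gauss sum G of the
   quartic character modulo pi satisfies G^4 = pi^2 N(pi), because the Jacobi sum
   is +-pi, and Frobenius computes G^q.  Hence (alpha / pi)_4 is, up to the sign
   (-1)^(rho gamma_2), the value of X_alpha = prod_q X_q^(v_q(alpha)) at pi, so the
   quartic condition is a condition on n modulo alpha.  In each residue class of n
   modulo 16 alpha, (HL) counts the primes n^2 + s^2, with a constant that does not
   depend on the class.  The number of classes comes from orthogonality and from
   sum_(n mod q) X_q(s + n i)^m = - X_q(i)^m (for q not dividing s and 4 not
   dividing m), which produces the factors of Omega_2 and Omega_4. *)

Require Import Defs.
From mathcomp Require Import all_boot all_order all_algebra complex.
From mathcomp Require Import all_field finmap ring zify.
From mathcomp Require Import all_classical all_reals all_analysis.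

Import Order.TTheory GRing.Theory Num.Theory.
Import numFieldNormedType.Exports.

Local Open Scope complex_scope.
Local Open Scope ring_scope.

Set Implicit Arguments.
Unset Strict Implicit.
Unset Printing Implicit Defensive.

(** * Gaussian integers *)

(** Each X_q comes from a field of characteristic q, and characters for different q must be
    multiplied. All character values therefore stay in Z[i], in {0, 1, -1, i, -i}: [gmap j] carries
    them into the field where a computation takes place and [nu j] reads them back. X_q(z) is a
    power of z / conj z or of its inverse, so it is 1 on rational integers prime to q, and X_q(s + n
    i) depends only on the ratio n : s; this is what ties the sum along one line to the sum over all
    of F_q[i]. (HL) sees only arguments m >= 1 of a quadratic polynomial, so positive and negative n
    are counted apart, each through blocks n = 16 alpha k - n0. The constant 1/16 arises as follows.
    Let v be the number of classes of n modulo alpha that meet the quartic condition. The 2v blocks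
    (two signs) each have constant 2/(16 alpha) times alpha/phi(alpha) times P, with P the product
    in (HL). Orthogonality gives 4v = phi(alpha) kappa G_d, where kappa collects the Euler factors
    of h_{1,r} at primes dividing alpha, which P omits; and kappa P = h_{1,r}. *)

Lemma gint_ext (z w : gint) : gre z = gre w -> gim z = gim w -> z = w.
Proof. by case: z w => [a b] [c d] /= -> ->. Qed.

Lemma greD (z w : gint) : gre (z + w) = gre z + gre w. Proof. by []. Qed.
Lemma gimD (z w : gint) : gim (z + w) = gim z + gim w. Proof. by []. Qed.
Lemma greN (z : gint) : gre (- z) = - gre z. Proof. by []. Qed.
Lemma gimN (z : gint) : gim (- z) = - gim z. Proof. by []. Qed.
Lemma greM (z w : gint) : gre (z * w) = gre z * gre w - gim z * gim w.
Proof. by []. Qed.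
Lemma gimM (z w : gint) : gim (z * w) = gre z * gim w + gim z * gre w.
Proof. by []. Qed.
Lemma gre0 : gre 0 = 0. Proof. by []. Qed.
Lemma gim0 : gim 0 = 0. Proof. by []. Qed.
Lemma gre1 : gre 1 = 1. Proof. by []. Qed.
Lemma gim1 : gim 1 = 0. Proof. by []. Qed.
Lemma grei : gre gi = 0. Proof. by []. Qed.
Lemma gimi : gim gi = 1. Proof. by []. Qed.
Lemma gre_nat n : gre n%:R = n%:Z.
Proof. by elim: n => // n IHn; rewrite -addn1 !natrD greD IHn gre1 PoszD. Qed.
Lemma gim_nat n : gim n%:R = 0.
Proof. by elim: n => // n IHn; rewrite -addn1 natrD gimD IHn gim1. Qed.
Lemma gre_int (n : int) : gre n%:~R = n.
Proof.
case: n => n; first by rewrite -pmulrn gre_nat.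
by rewrite NegzE mulrNz greN -pmulrn gre_nat.
Qed.
Lemma gim_int (n : int) : gim n%:~R = 0.
Proof.
case: n => n; first by rewrite -pmulrn gim_nat.
by rewrite NegzE mulrNz gimN -pmulrn gim_nat.
Qed.
Lemma gre_conj (z : gint) : gre (gconj z) = gre z. Proof. by []. Qed.
Lemma gim_conj (z : gint) : gim (gconj z) = - gim z. Proof. by []. Qed.

Definition gintE := (greD, gimD, greN, gimN, greM, gimM, gre0, gim0, gre1, gim1,
  grei, gimi, gre_nat, gim_nat, gre_int, gim_int, gre_conj, gim_conj).

Lemma sqr_gi : gi ^+ 2 = -1. Proof. by []. Qed.

Lemma gconjM (z w : gint) : gconj (z * w) = gconj z * gconj w.
Proof. by apply: gint_ext; rewrite !gintE; ring. Qed.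
Lemma gconjD (z w : gint) : gconj (z + w) = gconj z + gconj w.
Proof. by apply: gint_ext; rewrite !gintE; ring. Qed.

Lemma gint_normE (z : gint) : (gint_norm z)%:Z = gre z ^+ 2 + gim z ^+ 2.
Proof.
rewrite /gint_norm abszE ger0_norm gintE; first by rewrite !gintE; ring.
by rewrite !gintE mulrN opprK -!expr2 addr_ge0 ?sqr_ge0.
Qed.

Lemma mul_gconj (z : gint) : z * gconj z = (gint_norm z)%:R.
Proof.
by apply: gint_ext; rewrite !gintE ?gint_normE; ring.
Qed.

Lemma gint_normM (z w : gint) :
  gint_norm (z * w) = (gint_norm z * gint_norm w)%N.
Proof.
apply: (can_inj absz_nat); rewrite PoszM !gint_normE !gintE; ring.
Qed.

Lemma gint_norm_prod (ps : seq gint) :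
  gint_norm (\prod_(p <- ps) p) = (\prod_(p <- ps) gint_norm p)%N.
Proof. exact: (big_morph gint_norm gint_normM). Qed.

Lemma gint_norm_nat n : gint_norm n%:R = (n ^ 2)%N.
Proof.
by apply: (can_inj absz_nat); rewrite gint_normE !gintE expr0n addr0 -mulnn PoszM.
Qed.

Definition gunits : seq gint := [:: 1; -1; gi; - gi].

Lemma gunitsE (u : gint) : (u \in gunits) = (gint_norm u == 1)%N.
Proof.
apply/idP/idP; first by rewrite !inE => /or4P[]/eqP->.
move=> /eqP h; have := gint_normE u; rewrite h.
case: u {h} => a b /= h.
have h1 : (a = 0 /\ (b = 1 \/ b = -1)) \/ (b = 0 /\ (a = 1 \/ a = -1)).
  by nia.
by case: h1 => [[-> [->|->]]|[-> [->|->]]].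
Qed.

Lemma gunitP (u : gint) : gunit u <-> u \in gunits.
Proof.
rewrite gunitsE; split=> [[v hv]|/eqP h].
  by have /esym/eqP := gint_normM v u; rewrite -hv muln_eq1 => /andP[].
by exists (gconj u); rewrite mulrC mul_gconj h.
Qed.

Lemma gunitsM (u v : gint) : u \in gunits -> v \in gunits -> u * v \in gunits.
Proof. by rewrite !gunitsE gint_normM => /eqP-> /eqP->. Qed.

Lemma gunits4 (u : gint) : u \in gunits -> u ^+ 4 = 1.
Proof. by rewrite !inE => /or4P[]/eqP->. Qed.

Lemma gunits_sqr (u : gint) : u \in gunits -> u ^+ 2 = 1 \/ u ^+ 2 = -1.
Proof. by rewrite !inE => /or4P[]/eqP->; [left|left|right|right]. Qed.

Lemma gunits_conj (u : gint) : u \in gunits -> u * gconj u = 1.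
Proof. by rewrite !inE => /or4P[]/eqP->. Qed.

Lemma gint_eqN0 (z : gint) : z = - z -> z = 0.
Proof.
move=> h; apply: gint_ext; rewrite !gintE.
  by have := congr1 gre h; rewrite gintE; lia.
by have := congr1 gim h; rewrite gintE; lia.
Qed.

Lemma gint_mulIn (n : nat) (z w : gint) :
  (0 < n)%N -> n%:R * z = n%:R * w -> z = w.
Proof.
case: n => // n _ h.
apply: gint_ext.
  have := congr1 gre h; rewrite !gintE !mul0r !subr0 => /mulfI; exact.
have := congr1 gim h; rewrite !gintE !mul0r !addr0 => /mulfI; exact.
Qed.

(** * Homomorphisms from Z[i] and fourth roots of unity *)

Section GaussianMap.
Variables (K : comNzRingType) (j : K).
Hypothesis sqr_j : j ^+ 2 = -1.

(** The homomorphism sending i to j. With [K] = F_p it is reduction modulo a Gaussian prime, in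
    characteristic q it carries character values into the field of the Gauss sums, and with [K] =
    [R[i]] it is the inclusion into the complex numbers. *)
Definition gmap (z : gint) : K := (gre z)%:~R + (gim z)%:~R * j.

Lemma gmapD z w : gmap (z + w) = gmap z + gmap w.
Proof. by rewrite /gmap !gintE !rmorphD /=; ring. Qed.

Lemma gmapM z w : gmap (z * w) = gmap z * gmap w.
Proof.
have h : j * j = -1 by rewrite -expr2.
have e : gmap z * gmap w = (gre z)%:~R * (gre w)%:~R + ((gre z)%:~R * (gim w)%:~R
   + (gim z)%:~R * (gre w)%:~R) * j + (gim z)%:~R * (gim w)%:~R * (j * j).
  by rewrite /gmap; ring.
by rewrite e h /gmap !gintE rmorphB rmorphD /= !rmorphM /=; ring.
Qed.

Lemma gmapN z : gmap (- z) = - gmap z.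
Proof. by rewrite /gmap !gintE !rmorphN /=; ring. Qed.
Lemma gmapB z w : gmap (z - w) = gmap z - gmap w.
Proof. by rewrite gmapD gmapN. Qed.
Lemma gmap0 : gmap 0 = 0. Proof. by rewrite /gmap mul0r addr0. Qed.
Lemma gmap1 : gmap 1 = 1. Proof. by rewrite /gmap mul0r addr0. Qed.
Lemma gmapi : gmap gi = j. Proof. by rewrite /gmap mul1r add0r. Qed.
Lemma gmap_nat n : gmap n%:R = n%:R.
Proof. by rewrite /gmap !gintE mul0r addr0 pmulrn. Qed.
Lemma gmap_int (n : int) : gmap n%:~R = n%:~R.
Proof. by rewrite /gmap !gintE mul0r addr0. Qed.
Lemma gmapX z n : gmap (z ^+ n) = gmap z ^+ n.
Proof. by elim: n => [|n IHn]; rewrite ?gmap1 // !exprS gmapM IHn. Qed.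
Lemma gmap_sum (I : Type) (s : seq I) (P : pred I) (F : I -> gint) :
  gmap (\sum_(i <- s | P i) F i) = \sum_(i <- s | P i) gmap (F i).
Proof. exact: (big_morph gmap gmapD gmap0). Qed.
Lemma gmap_prod (I : Type) (s : seq I) (P : pred I) (F : I -> gint) :
  gmap (\prod_(i <- s | P i) F i) = \prod_(i <- s | P i) gmap (F i).
Proof. exact: (big_morph gmap gmapM gmap1). Qed.
Lemma gmap_norm z : gmap z * gmap (gconj z) = (gint_norm z)%:R.
Proof. by rewrite -gmapM mul_gconj gmap_nat. Qed.

End GaussianMap.

Section FourthRoots.
Variables (K : fieldType) (j : K).
Hypotheses (sqr_j : j ^+ 2 = -1) (two_neq0 : 2 != 0 :> K).

Let j_neq0 : j != 0.
Proof.
by apply/eqP => h; move: sqr_j; rewrite h expr0n /= => /esym/eqP; rewrite oppr_eq0 oner_eq0.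
Qed.

Lemma neq1N1 : (1 == -1 :> K) = false.
Proof. by rewrite -addr_eq0 -mulr2n (negPf two_neq0). Qed.
Lemma neqjNj : (j == - j) = false.
Proof. by rewrite -addr_eq0 -mulr2n -mulr_natr mulf_eq0 (negPf two_neq0) (negPf j_neq0). Qed.
Lemma neqj1 : (j == 1) = false.
Proof. by apply/eqP => h; move: sqr_j; rewrite h expr1n => /eqP; rewrite neq1N1. Qed.
Lemma neqjN1 : (j == -1) = false.
Proof. by apply/eqP => h; move: sqr_j; rewrite h sqrrN expr1n => /eqP; rewrite neq1N1. Qed.

(** Inverse of [gmap j] on 0 and the fourth roots of unity; any other y gets the default 0. *)
Definition nu (y : K) : gint :=
  if y == 1 then 1 else if y == -1 then -1 else
  if y == j then gi else if y == - j then - gi else 0.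

Lemma nu_gmap s : s \in 0 :: gunits -> nu (gmap j s) = s.
Proof.
have e := (neq1N1, neqjNj, neqj1, neqjN1).
have e0 : (0 == 1 :> K) = false by rewrite eq_sym oner_eq0.
have e1 : (-1 == 1 :> K) = false by rewrite eq_sym neq1N1.
rewrite in_cons => /orP[/eqP->|].
  rewrite gmap0 /nu e0 eq_sym oppr_eq0 oner_eq0 eq_sym (negPf j_neq0) eq_sym.
  by rewrite oppr_eq0 (negPf j_neq0).
rewrite !inE => /or4P[]/eqP->; rewrite ?gmapN ?gmap1 ?gmapi /nu ?eqxx ?e ?e1 //.
by rewrite eqr_oppLR neqjN1 eqr_opp neqj1 eq_sym neqjNj.
Qed.

Lemma nu_gunits y : nu y \in 0 :: gunits.
Proof. by rewrite /nu; do 4 (case: ifP => _ //). Qed.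

(** The hypothesis makes y zero or a fourth root of unity: y^5 - y = y(y - 1)(y + 1)(y - j)(y +
    j). *)
Lemma gmap_nu y : y ^+ 5 = y -> gmap j (nu y) = y.
Proof.
move=> h; have : y * ((y - 1) * (y + 1) * ((y - j) * (y + j))) = 0.
  have -> : y * ((y - 1) * (y + 1) * ((y - j) * (y + j))) =
            y * ((y ^+ 2 - 1) * (y ^+ 2 - j ^+ 2)) by ring.
  rewrite sqr_j opprK.
  have -> : y * ((y ^+ 2 - 1) * (y ^+ 2 + 1)) = y ^+ 5 - y by ring.
  by rewrite h subrr.
move/eqP; rewrite !mulf_eq0 !subr_eq0 !addr_eq0.
have e z s : s \in 0 :: gunits -> z = gmap j s -> gmap j (nu z) = z.
  by move=> hs ->; rewrite nu_gmap.
case/orP=> [/eqP->|/orP[/orP[]|/orP[]] /eqP->].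
- by apply: (e _ 0); rewrite ?gmap0.
- by apply: (e _ 1); rewrite ?gmap1.
- by apply: (e _ (-1)); rewrite ?gmapN ?gmap1.
- by apply: (e _ gi); rewrite ?gmapi.
- by apply: (e _ (-gi)); rewrite ?gmapN ?gmapi.
Qed.

Lemma gmap_inj : {in 0 :: gunits &, injective (gmap j)}.
Proof. exact: (can_in_inj nu_gmap). Qed.

Lemma gunits0M (u v : gint) :
  u \in 0 :: gunits -> v \in 0 :: gunits -> u * v \in 0 :: gunits.
Proof.
rewrite !(in_cons 0) => /orP[/eqP->|hu]; first by rewrite mul0r eqxx.
move=> /orP[/eqP->|hv]; first by rewrite mulr0 eqxx.
by rewrite gunitsM ?orbT.
Qed.

Lemma nuM y y' : y ^+ 5 = y -> y' ^+ 5 = y' -> nu (y * y') = nu y * nu y'.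
Proof.
move=> h h'; apply: gmap_inj; rewrite ?nu_gunits ?gunits0M ?nu_gunits //.
by rewrite gmapM // !gmap_nu // exprMn h h'.
Qed.

Lemma nu0 : nu 0 = 0. Proof. by have := @nu_gmap 0; rewrite gmap0; apply. Qed.
Lemma nu1 : nu 1 = 1. Proof. by have := @nu_gmap 1; rewrite gmap1; apply. Qed.
Lemma nuN1 : nu (-1) = -1.
Proof. by have := @nu_gmap (-1); rewrite gmapN gmap1; apply. Qed.

Lemma nu_eq0 y : y ^+ 5 = y -> (nu y == 0) = (y == 0).
Proof.
move=> h; apply/eqP/eqP => [e|->]; last exact: nu0.
by rewrite -(gmap_nu h) e gmap0.
Qed.

End FourthRoots.

(** * Gauss and Jacobi sums over 'F_p *)

Section GaussSums.
Variables (p : nat) (p_pr : prime p) (K : fieldType) (zeta : K).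
Hypotheses (zeta_p : zeta ^+ p = 1) (zeta_neq1 : zeta != 1).

Definition addchar (t : 'F_p) : K := zeta ^+ t.
Local Notation e := addchar.

Lemma addcharD t u : e (t + u) = e t * e u.
Proof.
have -> : e (t + u) = zeta ^+ ((t + u)%N %% p) by congr (_ ^+ (_ %% _)); exact: Fp_cast.
by rewrite /e -exprD [in RHS](divn_eq (t + u) p) exprD mulnC exprM zeta_p expr1n mul1r.
Qed.

Lemma addchar1 : e 1 = zeta.
Proof.
by rewrite /e -[1]/(1%:R) val_Fp_nat // modn_small ?prime_gt1.
Qed.

(** For a != 0, translating t by a^-1 multiplies the sum by [zeta], which is not 1. *)
Lemma addchar_sum (a : 'F_p) :
  \sum_t e (a * t) = if a == 0 then p%:R else 0.
Proof.
case: eqP => [->|/eqP a0].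
  under eq_bigr do rewrite mul0r /e expr0.
  by rewrite sumr_const card_Fp.
set S := LHS; have : zeta * S = S.
  rewrite /S mulr_sumr [RHS](reindex_inj (addrI a^-1)) /=.
  by apply: eq_bigr => t _; rewrite mulrDr mulfV // addcharD addchar1.
move/eqP; rewrite -subr_eq0 -{2}[S]mul1r -mulrBl mulf_eq0 subr_eq0.
by rewrite (negPf zeta_neq1) => /eqP.
Qed.

Definition gauss_sum (c : 'F_p -> K) : K := \sum_t c t * e t.
Definition jacobi_sum (c : 'F_p -> K) : K := \sum_t c t * c (1 - t).

Lemma mulchar_sum0 (c : 'F_p -> K) (t0 : 'F_p) :
  {morph c : x y / x * y} -> t0 != 0 -> c t0 != 1 -> \sum_t c t = 0.
Proof.
move=> cM h0 h1; set S := LHS; have : c t0 * S = S.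
  rewrite /S mulr_sumr [RHS](reindex_inj (mulfI h0)) /=.
  by apply: eq_bigr => t _; rewrite cM.
move/eqP; rewrite -subr_eq0 -{2}[S]mul1r -mulrBl mulf_eq0 subr_eq0.
by rewrite (negPf h1) => /eqP.
Qed.

(** [c'] is the inverse character of [c] and plays the role of the complex conjugate in any
    characteristic. Writing the variable of [c] as uv cancels c(u) against c'(u); the sum over u !=
    0 is then p - 1 at v = -1 and -1 elsewhere, and the -1 disappears because [c] sums to 0. *)
Lemma gauss_mul_conj (c c' : 'F_p -> K) :
    {morph c : x y / x * y} -> (forall t, c t * c' t = (t != 0)%:R) ->
    c 0 = 0 -> c' 0 = 0 -> \sum_t c t = 0 ->
  gauss_sum c * gauss_sum c' = c (-1) * p%:R.
Proof.
move=> cM cc' c0 c'0 sc.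
transitivity (\sum_(u | u != 0) \sum_v c v * e (u * (v + 1))).
  rewrite mulrC /gauss_sum mulr_suml (bigD1 0) //= c'0 !mul0r add0r.
  apply: eq_bigr => u u0; rewrite mulr_sumr (reindex_inj (mulfI u0)) /=.
  apply: eq_bigr => v _; rewrite mulrDr mulr1 addcharD cM.
  have -> : c' u * e u * (c u * c v * e (u * v)) =
     c u * c' u * (c v * (e (u * v) * e u)) by ring.
  by rewrite cc' u0 mul1r.
rewrite exchange_big /=.
transitivity (\sum_v c v * ((if v + 1 == 0 then p%:R else 0) - 1)).
  apply: eq_bigr => v _; rewrite -mulr_sumr; congr (_ * _).
  rewrite -addchar_sum [in RHS](bigD1 0) //= mulr0.
  have -> : e 0 = 1 by rewrite /e expr0.
  rewrite addrAC subrr add0r; apply: eq_bigr => u _; by rewrite mulrC.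
under eq_bigr do rewrite mulrBr mulr1.
rewrite sumrB sc subr0 (bigD1 (-1)) //= addNr eqxx.
rewrite big1 ?addr0 // => v; rewrite -subr_eq0 opprK => /negPf ->.
by rewrite mulr0.
Qed.

(** Pairs (t, u) are grouped by v = t + u. For v != 0 the scaling of t by v extracts c(v)^2 and the
    Jacobi sum; the pairs with v = 0 give c(-1) times the sum of c^2, which is 0. *)
Lemma gauss_sqr (c : 'F_p -> K) :
    {morph c : x y / x * y} -> \sum_t c t ^+ 2 = 0 ->
  gauss_sum c ^+ 2 = jacobi_sum c * gauss_sum (fun t => c t ^+ 2).
Proof.
move=> cM sc2.
transitivity (\sum_v \sum_t c t * c (v - t) * e v).
  rewrite expr2 mulr_suml exchange_big /=; apply: eq_bigr => t _.
  rewrite mulr_sumr (reindex_inj (addIr (- t))) /=.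
  apply: eq_bigr => v _; have -> : e v = e (v - t) * e t by rewrite -addcharD subrK.
  ring.
rewrite /gauss_sum mulr_sumr (bigD1 0) //= [RHS](bigD1 0) //=.
congr (_ + _).
  have e0 : e 0 = 1 by rewrite /e expr0.
  rewrite e0 -mulr_suml.
  have -> : \sum_i c i * c (0 - i) = c (-1) * \sum_i c i ^+ 2.
    rewrite mulr_sumr; apply: eq_bigr => i _.
    by rewrite sub0r -[- i]mulN1r cM; ring.
  (* On the right, the term v = 0 carries c(0)^2. If c(0) != 0 then c is constantly 1, the
     hypothesis reads p = 0 in [K], and the Jacobi sum, which is then p, vanishes. *)
  have [c00|] := eqVneq (c 0) 0.
    by rewrite sc2 c00 expr0n /=; ring.
  move=> c00; have c1 t : c t = 1.
    by apply: (mulfI c00); rewrite -cM mul0r mulr1.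
  have : \sum_(t : 'F_p) c t ^+ 2 = p%:R.
    under eq_bigr do rewrite c1 expr1n.
    by rewrite sumr_const card_Fp.
  rewrite sc2 => p0.
  rewrite /jacobi_sum; under eq_bigr do rewrite !c1 mulr1.
  by rewrite sumr_const card_Fp // -p0; ring.
apply: eq_bigr => v v0; rewrite -mulr_suml mulrA; congr (_ * _).
rewrite /jacobi_sum mulr_suml (reindex_inj (mulfI v0)) /=.
apply: eq_bigr => t _.
have -> : v - v * t = v * (1 - t) by ring.
rewrite !cM; ring.
Qed.

(** Frobenius acts termwise and e(t)^q = e(qt); the substitution of qt for t produces the factor
    c'(q). *)
Lemma gauss_frob (q : nat) (c c' : 'F_p -> K) :
    q \in [pchar K] -> q%:R != 0 :> 'F_p ->
    {morph c' : x y / x * y} -> (forall t, c t ^+ q = c' t) ->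
  gauss_sum c ^+ q * c' q%:R = gauss_sum c'.
Proof.
move=> chq q0 c'M cc'.
have -> : gauss_sum c ^+ q = pFrobenius_aut chq (gauss_sum c) by [].
rewrite /gauss_sum rmorph_sum mulr_suml [RHS](reindex_inj (mulfI q0)) /=.
apply: eq_bigr => t _; rewrite pFrobenius_autE exprMn cc' c'M.
have -> : e (q%:R * t) = e t ^+ q.
  elim: (q) => [|n IHn]; first by rewrite mul0r /e !expr0.
  by rewrite exprS -IHn -addcharD -natr1 mulrDl mul1r addrC.
ring.
Qed.

End GaussSums.

(** * The quartic character modulo a Gaussian prime *)

Lemma Fp_nat_eq0 (p n : nat) : prime p -> (n%:R == 0 :> 'F_p) = (p %| n)%N.
Proof. by move=> p_pr; rewrite (dvdn_pcharf (pchar_Fp p_pr)). Qed.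

Lemma Fp_int_eq0 (p : nat) (n : int) :
  prime p -> (n%:~R == 0 :> 'F_p) = (p%:Z %| n)%Z.
Proof.
move=> p_pr; rewrite [RHS]dvdzE absz_nat -(Fp_nat_eq0 _ p_pr).
case: n => n; first by rewrite -pmulrn.
by rewrite NegzE mulrNz oppr_eq0 abszN -pmulrn.
Qed.

Lemma Fp_expf_pred (p : nat) (t : 'F_p) : prime p -> t != 0 -> t ^+ p.-1 = 1.
Proof.
move=> p_pr t0; apply: (mulfI t0); rewrite -exprS prednK ?prime_gt0 // mulr1.
by have := expf_card t; rewrite card_Fp.
Qed.

(** X^k - 1 has at most k roots, fewer than the p - 1 nonzero residues. *)
Lemma exists_expf_neq1 (p k : nat) : prime p -> (0 < k < p.-1)%N ->
  exists2 t : 'F_p, t != 0 & t ^+ k != 1.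
Proof.
move=> p_pr /andP[k0 kp].
pose S := [seq t <- enum 'F_p | t != 0].
have [/hasP[t]|] := boolP (has (fun t : 'F_p => t ^+ k != 1) S).
  by rewrite mem_filter => /andP[t0 _] h; exists t.
rewrite -all_predC => /allP h.
have k_unity : all (fun t : 'F_p => k.-unity_root t) S.
  by apply/allP => t /h /=; rewrite negbK unity_rootE.
have uS : uniq S by rewrite filter_uniq ?enum_uniq.
have := max_unity_roots k0 k_unity uS.
have -> : size S = p.-1.
  rewrite -(card_uniqP uS) (@eq_card _ _ (predC1 (0 : 'F_p))).
    by rewrite cardC1 card_Fp.
  by move=> x; rewrite mem_filter mem_enum andbT.
by rewrite leqNgt kp.
Qed.

Lemma Fp_sum_expr (p k : nat) : prime p -> (k < p.-1)%N ->
  \sum_(t : 'F_p) t ^+ k = 0.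
Proof.
move=> p_pr; case: k => [_|k kp].
  under eq_bigr do rewrite expr0.
  by rewrite sumr_const card_Fp // pchar_Fp_0.
have [t t0 t1] := exists_expf_neq1 p_pr (kp : 0 < k.+1 < p.-1)%N.
by apply: (@mulchar_sum0 _ _ _ t) => // x y; rewrite exprMn.
Qed.

(** The size bound means degree at most p - 2, and power sums with exponent below p - 1 vanish. *)
Lemma Fp_sum_poly (p : nat) (f : {poly 'F_p}) : prime p -> (size f < p)%N ->
  \sum_(t : 'F_p) f.[t] = 0.
Proof.
move=> p_pr szf; under eq_bigr do rewrite horner_coef.
rewrite exchange_big /=; apply: big1 => i _.
rewrite -mulr_sumr Fp_sum_expr ?mulr0 //.
by rewrite (leq_trans (ltn_ord i)) // -ltnS prednK ?prime_gt0.
Qed.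

(* Thus [gmap iota] is the reduction modulo the Gaussian prime [w]. *)
Lemma gdvd_of_gmap (p : nat) (iota : 'F_p) (w z : gint) :
    prime p -> iota ^+ 2 = -1 -> gint_norm w = p ->
    gmap iota w = 0 -> gmap iota z = 0 -> gdvd w z.
Proof.
move=> p_pr hi hw w0 z0.
have d1 : (p%:Z %| gre (z * gconj w))%Z.
  rewrite -Fp_int_eq0 // !gintE.
  move: w0 z0; rewrite /gmap => /eqP; rewrite addr_eq0 => /eqP w0 /eqP.
  rewrite addr_eq0 => /eqP z0.
  rewrite rmorphB rmorphM rmorphM rmorphN /= w0 z0 mulrNN mulrACA -expr2 hi.
  by apply/eqP; ring.
have d2 : (p%:Z %| gim (z * gconj w))%Z.
  rewrite -Fp_int_eq0 // !gintE.
  move: w0 z0; rewrite /gmap => /eqP; rewrite addr_eq0 => /eqP w0 /eqP.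
  rewrite addr_eq0 => /eqP z0.
  rewrite rmorphD rmorphM rmorphM rmorphN /= w0 z0.
  by apply/eqP; ring.
have [a ha] := dvdzP d1; have [b hb] := dvdzP d2.
have zw : z * gconj w = p%:R * Gint a b.
  by apply: gint_ext; rewrite ?ha ?hb !gintE /=; ring.
exists (Gint a b).
apply: (@gint_mulIn p); first exact: prime_gt0.
by rewrite mulrA -zw mulrAC -mulrA mul_gconj hw mulrC.
Qed.

(** Outside the fixed points the values come in equal pairs; [enum_rank] selects one element of each
    orbit. *)
Lemma dvd2_sum_involution (T : finType) (s : T -> T) (f : T -> int) :
    involutive s -> (forall x, f (s x) = f x) ->
    (forall x, s x = x -> (2 %| f x)%Z) ->
  (2 %| \sum_x f x)%Z.
Proof.
move=> sK fs fix2; rewrite (bigID (fun x => s x == x)) rpredD //=.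
  by rewrite rpred_sum // => x /eqP; apply: fix2.
rewrite (bigID (fun x => (enum_rank x < enum_rank (s x))%N)) /=.
rewrite [X in _ + X](reindex_inj (inv_inj sK)) /=.
set S := (X in X + _); set S' := (X in _ + X).
suff -> : S' = S by apply/dvdzP; exists S; lia.
apply: eq_big => x; last by rewrite fs.
rewrite sK eq_sym -leqNgt leq_eqVlt.
have [//|sx /=] := eqVneq (s x) x.
by rewrite (inj_eq val_inj) (inj_eq enum_rank_inj) eq_sym (negPf sx).
Qed.

Section QuarticCharacter.
Variables (p : nat) (p_pr : prime p) (iota : 'F_p).
Hypotheses (sqr_iota : iota ^+ 2 = -1) (p_mod4 : (p %% 4 = 1)%N).

Let p_gt4 : (4 < p)%N.
Proof.
move: p_mod4; case: p p_pr => [|[|[|[|[|?]]]]] //.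
Qed.

Lemma p_pred4 : (4 * (p.-1 %/ 4) = p.-1)%N. Proof. by clear -p_mod4 p_gt4; lia. Qed.

Let M_gt0 : (0 < p.-1 %/ 4)%N. Proof. by clear -p_mod4 p_gt4; lia. Qed.

Let two_neq0 : 2 != 0 :> 'F_p.
Proof. by rewrite Fp_nat_eq0 // gtnNdvd //; apply: leq_trans p_gt4. Qed.

(** The quartic symbol modulo the Gaussian prime above p at which i reduces to [iota], lifted from
    F_p to Z[i]. *)
Definition chi (t : 'F_p) : gint := nu iota (t ^+ (p.-1 %/ 4)).

Let pow5 (t : 'F_p) : (t ^+ (p.-1 %/ 4)) ^+ 5 = t ^+ (p.-1 %/ 4).
Proof.
have [->|t0] := eqVneq t 0; first by rewrite !expr0n eqn0Ngt M_gt0 expr0n.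
by rewrite exprS -exprM mulnC p_pred4 Fp_expf_pred // mulr1.
Qed.

Lemma gmap_chi t : gmap iota (chi t) = t ^+ (p.-1 %/ 4).
Proof. exact: gmap_nu. Qed.

Lemma chiM : {morph chi : x y / x * y}.
Proof. by move=> x y; rewrite /chi exprMn nuM. Qed.

Lemma chi0 : chi 0 = 0.
Proof. by rewrite /chi expr0n eqn0Ngt M_gt0 nu0. Qed.

Lemma chi1 : chi 1 = 1.
Proof. by rewrite /chi expr1n nu1. Qed.

Lemma chi_eq0 t : (chi t == 0) = (t == 0).
Proof. by rewrite /chi nu_eq0 // expf_eq0 M_gt0. Qed.

Lemma chi_gunits t : t != 0 -> chi t \in gunits.
Proof.
move=> t0; have := nu_gunits iota (t ^+ (p.-1 %/ 4)).
by rewrite in_cons -/(chi t) chi_eq0 (negPf t0).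
Qed.

Lemma chiX t n : chi (t ^+ n) = chi t ^+ n.
Proof. by elim: n => [|n IHn]; rewrite ?chi1 // !exprS chiM IHn. Qed.

Lemma exists_chi_sqrN1 : exists2 t, t != 0 & chi t ^+ 2 = -1.
Proof.
have [|t t0 t1] := @exists_expf_neq1 p (p.-1 %/ 4 * 2) p_pr.
  by clear -p_mod4 p_gt4; lia.
exists t => //; have [h|//] := gunits_sqr (chi_gunits t0).
by case/eqP: t1; rewrite exprM -gmap_chi -gmapX // h gmap1.
Qed.

Definition jacobi : gint := \sum_t chi t * chi (1 - t).

(** Reduced modulo the prime, the Jacobi sum is the sum over F_p of (t(1 - t))^((p - 1)/4), a
    polynomial of degree (p - 1)/2 < p - 1. *)
Lemma gmap_jacobi0 : gmap iota jacobi = 0.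
Proof.
rewrite gmap_sum.
pose f : {poly 'F_p} := ('X * (1 - 'X)) ^+ (p.-1 %/ 4).
transitivity (\sum_t f.[t]).
  apply: eq_bigr => t _; rewrite (gmapM sqr_iota (chi t) (chi (1 - t))) !gmap_chi -exprMn.
  by rewrite /f !hornerE.
apply: Fp_sum_poly => //.
apply: leq_ltn_trans (size_poly_exp_leq _ _) _.
pose g : {poly 'F_p} := 'X * (1 - 'X).
have h : (size g <= 3)%N.
  apply: leq_trans (size_polyMleq _ _) _; rewrite size_polyX /= !ltnS.
  by rewrite (leq_trans (size_polyD _ _)) // size_polyN size_polyX size_poly1.
have {}h : ((size g).-1 <= 2)%N by case: (size g) h.
apply: (@leq_ltn_trans (2 * (p.-1 %/ 4)).+1); last by clear -p_mod4 p_gt4; lia.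
by rewrite ltnS leq_mul2r h orbT.
Qed.

(** The terms are invariant under t -> 1 - t, and at a fixed point the term chi(t)^2 is 1 or -1,
    hence real. This parity pins down the Jacobi sum among its associates, up to sign. *)
Lemma dvd2_gim_jacobi : (2 %| gim jacobi)%Z.
Proof.
rewrite /jacobi (big_morph gim gimD gim0).
apply: (@dvd2_sum_involution _ (fun t : 'F_p => 1 - t)) => [t|t|t et].
- exact: subKr.
- by rewrite subKr (mulrC (chi t) (chi (1 - t))).
have t0 : t != 0.
  by apply/eqP => t0; move/eqP: et; rewrite t0 subr0 oner_eq0.
have -> : gim (chi t * chi (1 - t)) = gim (chi t ^+ 2) by rewrite et expr2.
by have [->|->] := gunits_sqr (chi_gunits t0).
Qed.

Section InField.
Variables (K : fieldType) (j zeta : K).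
Hypotheses (sqr_j : j ^+ 2 = -1) (two_neq0K : 2 != 0 :> K).
Hypotheses (zeta_p : zeta ^+ p = 1) (zeta_neq1 : zeta != 1).

Let c t := gmap j (chi t).
Let c' t := gmap j (gconj (chi t)).

Let cM : {morph c : x y / x * y}.
Proof. by move=> x y; rewrite /c chiM gmapM. Qed.
Let c'M : {morph c' : x y / x * y}.
Proof. by move=> x y; rewrite /c' chiM gconjM gmapM. Qed.
Let c0 : c 0 = 0. Proof. by rewrite /c chi0 gmap0. Qed.
Let c'0 : c' 0 = 0. Proof. by rewrite /c' chi0 gmap0. Qed.

Lemma gmap_chi_conj t : gmap j (chi t) * gmap j (gconj (chi t)) = (t != 0)%:R.
Proof.
have [->|t0] := eqVneq t 0; first by rewrite chi0 gmap0 mul0r.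
by rewrite -gmapM // gunits_conj ?gmap1 ?chi_gunits.
Qed.

Let c4 t : t != 0 -> c t ^+ 4 = 1.
Proof. by move=> t0; rewrite /c -gmapX // gunits4 ?gmap1 ?chi_gunits. Qed.

Let c'E t : c' t = c t ^+ 3.
Proof.
have [->|t0] := eqVneq t 0; first by rewrite c'0 c0 expr0n.
have := gmap_chi_conj t; rewrite t0 -/(c t) -/(c' t) => h.
by rewrite -[c' t]mul1r -(c4 t0) exprSr -mulrA h mulr1.
Qed.

Let sqr_c' t : c' t ^+ 2 = c t ^+ 2.
Proof.
have [->|t0] := eqVneq t 0; first by rewrite c'0 c0.
by rewrite c'E -exprM -[(3 * 2)%N]/(4 + 2)%N exprD c4 // mul1r.
Qed.

Let sum_c : \sum_t c t = 0.
Proof.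
have [t t0 h] := exists_chi_sqrN1; apply: (mulchar_sum0 (t0 := t)) => //.
apply/eqP => h1; have : c t ^+ 2 = -1 by rewrite /c -gmapX // h gmapN gmap1.
by move/eqP; rewrite h1 expr1n neq1N1.
Qed.

Let sum_c2 : \sum_t c t ^+ 2 = 0.
Proof.
have [t t0 h] := exists_chi_sqrN1; apply: (mulchar_sum0 (t0 := t)) => //.
  by move=> x y; rewrite cM exprMn.
by rewrite /c -gmapX // h gmapN gmap1 eq_sym neq1N1.
Qed.

Let gauss_c2 : gauss_sum zeta (fun t => c t ^+ 2) ^+ 2 = p%:R.
Proof.
rewrite expr2 (gauss_mul_conj p_pr zeta_p zeta_neq1) //.
- have -> : c (-1) ^+ 2 = 1 by rewrite expr2 -cM mulrNN mulr1 /c chi1 gmap1.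
  by rewrite mul1r.
- by move=> x y; rewrite cM exprMn.
- move=> t; have [->|t0] := eqVneq t 0; first by rewrite c0 expr0n mul0r.
  by rewrite -exprD c4.
- by rewrite c0 expr0n.
- by rewrite c0 expr0n.
Qed.

Let jacobi_c : jacobi_sum c = gmap j jacobi.
Proof. by rewrite gmap_sum; apply: eq_bigr => t _; rewrite gmapM. Qed.

Let jacobi_c' : jacobi_sum c' = gmap j (gconj jacobi).
Proof.
have -> : gconj jacobi = \sum_t gconj (chi t) * gconj (chi (1 - t)).
  rewrite /jacobi (big_morph gconj gconjD (erefl : gconj 0 = 0)).
  by apply: eq_bigr => t _; rewrite gconjM.
by rewrite gmap_sum; apply: eq_bigr => t _; rewrite gmapM.
Qed.

Lemma gauss_chi_mul_conj :
  gauss_sum zeta (fun t => gmap j (chi t)) *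
  gauss_sum zeta (fun t => gmap j (gconj (chi t))) = gmap j (chi (-1)) * p%:R.
Proof. by apply: (gauss_mul_conj p_pr zeta_p zeta_neq1) => // t; apply: gmap_chi_conj. Qed.

Lemma gauss_chi4 :
  gauss_sum zeta (fun t => gmap j (chi t)) ^+ 4 = gmap j (jacobi ^+ 2) * p%:R.
Proof.
have := gauss_sqr p_pr zeta_p cM sum_c2 => h.
by rewrite (exprM _ 2 2) h exprMn gauss_c2 gmapX // jacobi_c.
Qed.

(** G(c)^2 = J G(c^2) is multiplied by its conjugate; with G(c^2)^2 = p and (G(c) G(c'))^2 = p^2
    this becomes p^2 = N(J) p. In characteristic 0 it determines N(J). *)
Lemma gmap_jacobi_norm : p%:R != 0 :> K -> (gint_norm jacobi)%:R = p%:R :> K.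
Proof.
move=> p0.
have h := gauss_sqr p_pr zeta_p cM sum_c2.
have sum_c'2 : \sum_t c' t ^+ 2 = 0 by under eq_bigr do rewrite sqr_c'.
have := gauss_sqr p_pr zeta_p c'M sum_c'2.
have -> : gauss_sum zeta (fun t => c' t ^+ 2) = gauss_sum zeta (fun t => c t ^+ 2).
  by apply: eq_bigr => t _; rewrite sqr_c'.
move=> h'; have := congr1 (fun x => x ^+ 2) gauss_chi_mul_conj.
rewrite !exprMn -gmapX // -chiX sqrrN expr1n chi1 gmap1 mul1r.
rewrite h h' mulrACA -expr2 gauss_c2 jacobi_c jacobi_c' gmap_norm // expr2.
exact/mulIf.
Qed.

End InField.

Lemma gint_norm_jacobi : gint_norm jacobi = p.
Proof.
have [zeta hz] := C_prim_root_exists (prime_gt0 p_pr).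
have e0 n : (n%:R == 0 :> algC) = (n == 0)%N by rewrite pnatr_eq0.
apply/eqP; rewrite -(eqr_nat algC); apply/eqP.
apply: (@gmap_jacobi_norm _ (sqrtC (-1)) zeta); rewrite ?sqrtCK ?e0 -?lt0n ?prime_gt0 //.
- by rewrite [LHS](prim_expr_order hz).
apply/negP => /eqP h1; have := prim_order_dvd hz 1; rewrite h1 expr1n eqxx.
by rewrite dvdn1 => /eqP e; move: p_gt4; rewrite e.
Qed.

(** Both J and w have norm p and reduce to 0 under [iota], so J = uw with u a unit. Both have even
    imaginary part and w has odd real part, which leaves u = 1 or -1; squaring removes the sign. *)
Lemma jacobi_sqr (w : gint) :
    gint_norm w = p -> gmap iota w = 0 -> (2 %| gim w)%Z ->
  jacobi ^+ 2 = w ^+ 2.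
Proof.
move=> nw w0 w2.
have [u hu] := gdvd_of_gmap p_pr sqr_iota nw w0 gmap_jacobi0.
have uu : u \in gunits.
  rewrite gunitsE; have := gint_norm_jacobi; rewrite hu gint_normM nw.
  by rewrite -[X in _ = X]mul1n => /eqP; rewrite eqn_mul2r eqn0Ngt prime_gt0.
have re_odd : ~ (2 %| gre w)%Z.
  move: p_pr p_gt4 w2 (gint_normE w); rewrite nw; clear.
  move=> p_pr p4 h2 e h1.
  have [p2|o] := even_prime p_pr; first by rewrite p2 in p4.
  have : (2 %| p%:Z)%Z by rewrite e rpredD // dvdz_exp.
  by rewrite dvdzE absz_nat dvdn2 o.
have := dvd2_gim_jacobi; rewrite hu exprMn.
move=> h2.
suff -> : u ^+ 2 = 1 by rewrite mul1r.
move: uu h2; rewrite !inE => /or4P[] /eqP-> //; last first.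
  by rewrite !gintE oppr0 mul0r add0r mulN1r rpredN.
by rewrite !gintE mul0r add0r mul1r.
Qed.

End QuarticCharacter.

(** * The quartic symbol with rational denominator *)

Lemma Fp_exists_sqrN1 (p : nat) : prime p -> (p %% 4 = 1)%N ->
  exists iota : 'F_p, iota ^+ 2 = -1.
Proof.
move=> p_pr p4.
have p_gt4 : (4 < p)%N by case: p p_pr p4 => [|[|[|[|[|?]]]]].
have [|t t0 t1] := @exists_expf_neq1 p (p.-1 %/ 2) p_pr.
  by clear -p4 p_gt4; lia.
exists (t ^+ (p.-1 %/ 4)); rewrite -exprM.
have -> : (p.-1 %/ 4 * 2 = p.-1 %/ 2)%N by clear -p4 p_gt4; lia.
have : (t ^+ (p.-1 %/ 2)) ^+ 2 == 1.
  rewrite -exprM; have -> : (p.-1 %/ 2 * 2 = p.-1)%N by clear -p4 p_gt4; lia.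
  by rewrite Fp_expf_pred.
by rewrite sqrf_eq1 (negPf t1) => /eqP.
Qed.

Lemma Fp_no_sqrN1 (p : nat) (t : 'F_p) : prime p -> (p %% 4 = 3)%N -> t ^+ 2 != -1.
Proof.
move=> p_pr p4; apply/eqP => h.
have t0 : t != 0.
  by apply/eqP => t0; move/eqP: h; rewrite t0 expr0n /= eq_sym oppr_eq0 oner_eq0.
have := Fp_expf_pred p_pr t0.
have -> : p.-1 = (2 * (p.-1 %/ 4 * 2 + 1))%N by clear -p4; lia.
rewrite exprM h exprD exprM exprAC sqrrN !expr1n mul1r => /eqP.
rewrite eq_sym neq1N1 // Fp_nat_eq0 // gtnNdvd //.
by case: p p_pr p4 {t h t0} => [|[|[|?]]].
Qed.

Lemma Fp_card_sqrN1 (p : nat) : prime p -> odd p ->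
  #|[pred t : 'F_p | t ^+ 2 == -1]| = (if p %% 4 == 1 then 2 else 0)%N.
Proof.
move=> p_pr p_odd; have two0 : 2 != 0 :> 'F_p.
  rewrite Fp_nat_eq0 // gtnNdvd //.
  by case: p p_pr p_odd => [|[|[|?]]].
case: eqP => [/(Fp_exists_sqrN1 p_pr)[i hi]|p4].
  have -> : #|[pred t : 'F_p | t ^+ 2 == -1]| = #|pred2 i (- i)|.
    by apply: eq_card => t; rewrite !inE -hi eqf_sqr.
  by rewrite card2 neqjNj.
apply: eq_card0 => t; rewrite !inE; apply: negPf; apply: Fp_no_sqrN1 => //.
by clear -p_odd p4; lia.
Qed.

Section TorusCharacter.
Variables (q : nat) (q_pr : prime q) (q_odd : odd q).
Variables (K : fieldType) (f : {rmorphism 'F_q -> K}) (j : K).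
Hypothesis sqr_j : j ^+ 2 = -1.

Local Notation M := (q.+1 %/ 4)%N.

Let q_gt2 : (2 < q)%N.
Proof. by move: q_odd; case: q q_pr => [|[|[|?]]]. Qed.

Let M_gt0 : (0 < M)%N. Proof. by rewrite divn_gt0. Qed.

Let chK : q \in [pchar K].
Proof. by rewrite (fmorph_pchar f) pchar_Fp. Qed.

Let two_neq0 : 2 != 0 :> K.
Proof. by rewrite -(dvdn_pcharf chK) gtnNdvd. Qed.

Let j_neq0 : j != 0.
Proof.
by apply/eqP => h; move: sqr_j; rewrite h expr0n /= => /esym/eqP; rewrite oppr_eq0 oner_eq0.
Qed.

Let fq a : f a ^+ q = f a.
Proof. by have := expf_card a; rewrite card_Fp // => h; rewrite -rmorphXn h. Qed.

Let q4 : (q %% 4 == 1)%N || (q %% 4 == 3)%N.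
Proof. by clear -q_odd; lia. Qed.

(* For z = a + b j this is z / zbar or its inverse.  The sign is chosen so that
   the power (q + 1) / 4 (rounded down) is the quartic symbol of z modulo q; for
   q = 3 mod 4 it equals z ^ ((q ^ 2 - 1) / 4), as z ^ q = zbar. *)
Definition torus (a b : 'F_q) : K :=
  if (q %% 4 == 1)%N then (f a + f b * j) / (f a - f b * j)
  else (f a - f b * j) / (f a + f b * j).

Definition torus_char (a b : 'F_q) : gint := nu j (torus a b ^+ M).

Lemma jq : j ^+ q = if (q %% 4 == 1)%N then j else - j.
Proof.
have j4 : j ^+ 4 = 1 by rewrite (exprM _ 2 2) sqr_j sqrrN expr1n.
rewrite {1}(divn_eq q 4) exprD mulnC exprM j4 expr1n mul1r.
have := q4; case: eqP => [-> _|_ /= /eqP ->]; first by rewrite expr1.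
by rewrite exprSr sqr_j mulN1r.
Qed.

Lemma frob_j (a b : 'F_q) : (f a + f b * j) ^+ q =
  if (q %% 4 == 1)%N then f a + f b * j else f a - f b * j.
Proof.
have -> : (f a + f b * j) ^+ q = pFrobenius_aut chK (f a + f b * j) by [].
by rewrite rmorphD rmorphM /= !pFrobenius_autE !fq jq; case: ifP; rewrite ?mulrN.
Qed.

Lemma mul_torus (a b : 'F_q) :
  (f a + f b * j) * (f a - f b * j) = f (a ^+ 2 + b ^+ 2).
Proof.
have -> : (f a + f b * j) * (f a - f b * j) = f a ^+ 2 - f b ^+ 2 * j ^+ 2 by ring.
by rewrite sqr_j mulrN1 opprK rmorphD !rmorphXn.
Qed.

Lemma torus_eq0 a b : (torus a b == 0) = (a ^+ 2 + b ^+ 2 == 0).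
Proof.
rewrite -(fmorph_eq0 f) -mul_torus /torus mulf_eq0.
by case: ifP; rewrite mulf_eq0 invr_eq0 // orbC.
Qed.

(** 4M is q - 1 or q + 1, the order of the group of elements of norm 1 in F_q[i]. Frobenius fixes a
    + bj and a - bj when q = 1 mod 4 and exchanges them when q = 3 mod 4. *)
Lemma torus_expr a b : torus a b != 0 -> torus a b ^+ (4 * M) = 1.
Proof.
rewrite torus_eq0 -(fmorph_eq0 f) -mul_torus mulf_eq0 negb_or => /andP[A0 B0].
have hA := frob_j a b; have hB := frob_j a (- b).
rewrite rmorphN mulNr opprK in hB; rewrite /torus.
have := q4; case: eqP hA hB => [e hA hB _|_ hA hB /= /eqP e].
  have -> : (4 * M = q.-1)%N by clear -e q_gt2; lia.
  rewrite expr_div_n.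
  have h (x : K) : x != 0 -> x ^+ q = x -> x ^+ q.-1 = 1.
    by move=> x0 hx; apply: (mulfI x0); rewrite -exprS prednK ?prime_gt0 // mulr1.
  by rewrite !h // divr1.
have -> : (4 * M = q.+1)%N by clear -e q_gt2; lia.
rewrite exprSr expr_div_n hA hB mulrACA -invfM (mulrC (f a + _)) mulfV //.
by rewrite mulf_neq0.
Qed.

Let pow5 a b : (torus a b ^+ M) ^+ 5 = torus a b ^+ M.
Proof.
have [->|t0] := eqVneq (torus a b) 0.
  by rewrite !expr0n eqn0Ngt M_gt0 expr0n.
by rewrite exprS -exprM mulnC torus_expr // mulr1.
Qed.

Lemma torus_char_gunits0 a b : torus_char a b \in 0 :: gunits.
Proof. exact: nu_gunits. Qed.

Lemma torus_char_eq0 a b : (torus_char a b == 0) = (a ^+ 2 + b ^+ 2 == 0).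
Proof. by rewrite /torus_char nu_eq0 // expf_eq0 M_gt0 torus_eq0. Qed.

Lemma torus_char_gunits a b : a ^+ 2 + b ^+ 2 != 0 -> torus_char a b \in gunits.
Proof. by have := torus_char_gunits0 a b; rewrite in_cons torus_char_eq0 => /orP[->|]. Qed.

Lemma torus_charM a b c d : torus_char (a * c - b * d) (a * d + b * c) = torus_char a b * torus_char c d.
Proof.
rewrite /torus_char -nuM // -exprMn; congr (nu j (_ ^+ _)).
have e1 : f (a * c - b * d) + f (a * d + b * c) * j =
          (f a + f b * j) * (f c + f d * j).
  have -> : (f a + f b * j) * (f c + f d * j) =
     f a * f c + f b * f d * j ^+ 2 + (f a * f d + f b * f c) * j by ring.
  by rewrite sqr_j rmorphB rmorphD !rmorphM /= mulrN1.
have e2 : f (a * c - b * d) - f (a * d + b * c) * j =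
          (f a - f b * j) * (f c - f d * j).
  have -> : (f a - f b * j) * (f c - f d * j) =
     f a * f c + f b * f d * j ^+ 2 - (f a * f d + f b * f c) * j by ring.
  by rewrite sqr_j rmorphB rmorphD !rmorphM /= mulrN1.
by rewrite /torus e1 e2; case: ifP => _; rewrite mulf_div.
Qed.

Lemma torus_char_rat a : a != 0 -> torus_char a 0 = 1.
Proof.
move=> a0; rewrite /torus_char /torus rmorph0 mul0r addr0 subr0 divff ?fmorph_eq0 //.
by rewrite if_same expr1n nu1.
Qed.

Lemma torus_char_scale a b c : c != 0 -> torus_char (c * a) (c * b) = torus_char a b.
Proof.
by move=> c0; rewrite -[RHS]mul1r -(torus_char_rat c0) -torus_charM !mul0r subr0 addr0.
Qed.

Lemma torus_char01 : torus_char 0 1 = (-1) ^+ M.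
Proof.
have e : torus 0 1 = -1.
  rewrite /torus rmorph0 rmorph1 mul1r add0r sub0r divrN mulNr divff //.
  by rewrite if_same.
rewrite /torus_char e -[(-1 : K) ^+ _]signr_odd -[(-1 : gint) ^+ _]signr_odd; case: (odd M); last by rewrite !expr0 nu1.
by rewrite !expr1 nuN1.
Qed.

(** t -> (1 + tj)/(1 - tj) is a Moebius transformation of determinant 2j != 0. *)
Lemma torus1_inj : {in [pred t | 1 + t ^+ 2 != 0] &, injective (torus 1)}.
Proof.
move=> t t'; rewrite !inE => h h' e.
have {h'} : (1 + f t' * j) * (1 - f t' * j) != 0.
  by rewrite -(rmorph1 f) mul_torus fmorph_eq0 expr1n.
have {h} : (1 + f t * j) * (1 - f t * j) != 0.
  by rewrite -(rmorph1 f) mul_torus fmorph_eq0 expr1n.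
rewrite !mulf_eq0 !negb_or => /andP[h1 h2] /andP[h3 h4].
have {}e : (1 + f t * j) / (1 - f t * j) = (1 + f t' * j) / (1 - f t' * j).
  move: e; rewrite /torus rmorph1; case: ifP => // _ e.
  by apply: invr_inj; rewrite !invf_div.
move/eqP: e; rewrite eqr_div // => /eqP e.
have : (2 * j) * (f t - f t') = 0.
  have -> : (2 * j) * (f t - f t') = (1 + f t * j) * (1 - f t' * j) -
     (1 + f t' * j) * (1 - f t * j) by ring.
  by rewrite e subrr.
move/eqP; rewrite !mulf_eq0 (negPf two_neq0) (negPf j_neq0) /= subr_eq0.
by move/eqP/fmorph_inj.
Qed.

Lemma card_torus : #|[pred t : 'F_q | 1 + t ^+ 2 != 0]| =
  (if q %% 4 == 1 then q - 2 else q)%N.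
Proof.
have := cardC [pred t : 'F_q | t ^+ 2 == -1].
rewrite card_Fp // Fp_card_sqrN1 // => h.
rewrite -(@eq_card _ (predC [pred t : 'F_q | t ^+ 2 == -1])).
  by move: h; case: ifP => _ h; have := canRL (addKn _) h; rewrite ?subn0.
by move=> t; rewrite !inE addrC addr_eq0.
Qed.

(** The character has exact order 4: otherwise X^(2M) - 1, of degree (q - 1)/2 or (q + 1)/2, would
    have q - 2 or q distinct roots respectively. *)
Lemma exists_torus_char_sqrN1 : exists2 t, 1 + t ^+ 2 != 0 & torus_char 1 t ^+ 2 = -1.
Proof.
pose S := enum [pred t : 'F_q | 1 + t ^+ 2 != 0].
have [/hasP[t]|] := boolP (has (fun t => torus 1 t ^+ (M * 2) != 1) S).
  rewrite mem_enum inE => t0 ht; exists t => //.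
  have [|h|//] := gunits_sqr (@torus_char_gunits 1 t _); first by rewrite expr1n.
  case/eqP: ht; rewrite exprM -(gmap_nu sqr_j two_neq0 (pow5 1 t)) -/(torus_char 1 t).
  by rewrite -gmapX // h gmap1.
rewrite -all_predC => /allP h.
have u_unity : all (M * 2).-unity_root [seq torus 1 t | t <- S].
  by apply/allP => _ /mapP[t tS ->]; have /= := h t tS; rewrite negbK unity_rootE.
have uS : uniq [seq torus 1 t | t <- S].
  rewrite map_inj_in_uniq ?enum_uniq // => t t'; rewrite !mem_enum.
  exact: torus1_inj.
have M2 : (0 < M * 2)%N by rewrite muln_gt0 M_gt0.
have := max_unity_roots M2 u_unity uS.
rewrite size_map -cardE card_torus.
by case: ifP => e; clear -e q_gt2 q_odd; lia.
Qed.

Lemma torus_char0 (b : 'F_q) : b != 0 -> torus_char 0 b = torus_char 0 1.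
Proof. by move=> b0; rewrite -[LHS](torus_char_scale _ _ (invr_neq0 b0)) mulr0 mulVf. Qed.

Lemma sum_torus_char0 m : (0 < m)%N ->
  \sum_(b : 'F_q) torus_char 0 b ^+ m = q.-1%:R * torus_char 0 1 ^+ m.
Proof.
move=> m0; rewrite (bigD1 0) //= (eqP (_ : torus_char 0 0 == 0)); last first.
  by rewrite torus_char_eq0 expr0n addr0.
rewrite expr0n eqn0Ngt m0 add0r (eq_bigr (fun=> torus_char 0 1 ^+ m)).
  by rewrite sumr_const cardC1 card_Fp // mulr_natl.
by move=> b b0; rewrite torus_char0.
Qed.

Lemma sum_torus_char_scale a m : a != 0 ->
  \sum_(b : 'F_q) torus_char a b ^+ m = \sum_(b : 'F_q) torus_char 1 b ^+ m.
Proof.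
move=> a0; rewrite (reindex_inj (mulfI a0)).
by apply: eq_bigr => b _; rewrite -{1}[a]mulr1 torus_char_scale.
Qed.

Lemma sum_torus_char_dvd4 m : (0 < m)%N -> (4 %| m)%N ->
  \sum_(b : 'F_q) torus_char 1 b ^+ m = (if q %% 4 == 1 then q - 2 else q)%N%:R.
Proof.
move=> m0 /dvdnP[k mk]; rewrite -card_torus -sum1_card natr_sum.
rewrite [RHS]big_mkcond; apply: eq_bigr => t _; rewrite inE.
have [h|h] := boolP (1 + t ^+ 2 == 0).
  have /eqP -> : torus_char 1 t == 0 by rewrite torus_char_eq0 expr1n.
  by rewrite expr0n eqn0Ngt m0.
by rewrite mk mulnC exprM gunits4 ?expr1n // torus_char_gunits ?expr1n.
Qed.

(** Since the character is constant on rational multiples, the sum S over all of F_q[i] is q - 1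
    times X(i)^m plus the sum over the line a = 1. Multiplication by an element with X^m = -1
    permutes F_q[i], so S = -S. *)
Lemma sum_torus_char_ndvd4 m : ~~ (4 %| m)%N ->
  \sum_(b : 'F_q) torus_char 1 b ^+ m = - torus_char 0 1 ^+ m.
Proof.
move=> m4; have m0 : (0 < m)%N by case: m m4.
pose S := \sum_(a : 'F_q) \sum_(b : 'F_q) torus_char a b ^+ m.
have hS : S = q.-1%:R * (torus_char 0 1 ^+ m + \sum_(b : 'F_q) torus_char 1 b ^+ m).
  rewrite /S (bigD1 0) //= sum_torus_char0 // mulrDr; congr (_ + _).
  rewrite (eq_bigr (fun=> \sum_(b : 'F_q) torus_char 1 b ^+ m)).
    by rewrite sumr_const cardC1 card_Fp // mulr_natl.
  by move=> a a0; rewrite sum_torus_char_scale.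
have S0 : S = 0.
  have key a b : torus_char a b ^+ m = -1 -> S = - S.
    move=> hm; have hu : a ^+ 2 + b ^+ 2 != 0.
      rewrite -torus_char_eq0; apply/eqP => h.
      by move/eqP: hm; rewrite h expr0n eqn0Ngt m0.
    rewrite -mulN1r -hm /S !pair_big mulr_sumr.
    have inj : injective (fun x : 'F_q * 'F_q => (a * x.1 - b * x.2, a * x.2 + b * x.1)).
      move=> [x y] [x' y'] e.
      have e1 : a * x - b * y = a * x' - b * y' := congr1 fst e.
      have e2 : a * y + b * x = a * y' + b * x' := congr1 snd e.
      have h1 : (a ^+ 2 + b ^+ 2) * x = (a ^+ 2 + b ^+ 2) * x'.
        have -> : (a ^+ 2 + b ^+ 2) * x = a * (a * x - b * y) + b * (a * y + b * x) by ring.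
        by rewrite e1 e2; ring.
      have h2 : (a ^+ 2 + b ^+ 2) * y = (a ^+ 2 + b ^+ 2) * y'.
        have -> : (a ^+ 2 + b ^+ 2) * y = a * (a * y + b * x) - b * (a * x - b * y) by ring.
        by rewrite e1 e2; ring.
      by rewrite (mulfI hu h1) (mulfI hu h2).
    rewrite [LHS](reindex_inj inj).
    by apply: eq_bigr => -[x y] _ /=; rewrite torus_charM exprMn.
  apply: gint_eqN0.
  (* Let z = 1 + ti, with X(z)^2 = -1. For m odd the element z^2 has X^m = -1; for m = 2 mod 4 the
     element z itself does. *)
  have [t t0 ht] := exists_torus_char_sqrN1.
  have [m2|m2] := boolP (odd m).
    apply: (key (1 * 1 - t * t) (1 * t + t * 1)); rewrite torus_charM -expr2 ht.
    by rewrite -signr_odd m2.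
  apply: (key 1 t); rewrite -[m]odd_double_half (negPf m2) add0n -mul2n exprM ht.
  have o2 : odd m./2 by move: m4 m2; clear; lia.
  by rewrite -signr_odd o2.
apply/eqP; rewrite -addr_eq0 addrC; apply/eqP.
apply: (@gint_mulIn q.-1); first by clear -q_gt2; lia.
by rewrite -hS S0 mulr0.
Qed.

Definition qchar (z : gint) : gint := torus_char (gre z)%:~R (gim z)%:~R.

Lemma qcharM z w : qchar (z * w) = qchar z * qchar w.
Proof. by rewrite /qchar -torus_charM !gintE rmorphB rmorphD !rmorphM. Qed.

(** * Quartic reciprocity for a rational argument *)

Section Reciprocity.
Variables (p : nat) (iota : 'F_p) (zeta : K) (w : gint).
Hypotheses (p_pr : prime p) (p4 : (p %% 4 = 1)%N) (sqr_iota : iota ^+ 2 = -1).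
Hypotheses (zeta_p : zeta ^+ p = 1) (zeta_neq1 : zeta != 1) (pq : p != q).
Hypotheses (nw : gint_norm w = p) (w0 : gmap iota w = 0) (w2 : (2 %| gim w)%Z).

(** Let A and B be the images of w and conj w in [K], so that AB = p and G^4 = A^3 B. For q = 1 mod
    4 Frobenius gives G^(4M) c(q) = 1, and A^(4M) = 1 turns (A^3 B)^M into the inverse of (A/B)^M.
    For q = 3 mod 4 it gives G^(4M) = c(-q) AB, the sign coming from G(c) G(c') = c(-1) p, and A^q =
    B turns (A^3 B)^M into AB (B/A)^M. *)
Lemma qchar_reciprocity :
  chi iota (if (q %% 4 == 1)%N then q%:R else - q%:R) = qchar w.
Proof.
have pK : p%:R != 0 :> K by rewrite -(dvdn_pcharf chK) dvdn_prime2 // eq_sym.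
have qF : q%:R != 0 :> 'F_p by rewrite Fp_nat_eq0 // dvdn_prime2.
pose c t := gmap j (chi iota t); pose c' t := gmap j (gconj (chi iota t)).
have cM : {morph c : x y / x * y} by move=> x y; rewrite /c chiM // gmapM.
have c'M : {morph c' : x y / x * y} by move=> x y; rewrite /c' chiM // gconjM gmapM.
have cc' := gmap_chi_conj p_pr sqr_iota p4 sqr_j.
have cF t : c t ^+ q = if (q %% 4 == 1)%N then c t else c' t.
  rewrite /c /c' /gmap; have := frob_j (gre (chi iota t))%:~R (gim (chi iota t))%:~R.
  by rewrite !rmorph_int gim_conj gre_conj rmorphN mulNr.
have GG := gauss_chi_mul_conj p_pr sqr_iota p4 sqr_j two_neq0 zeta_p zeta_neq1.
have G4 := gauss_chi4 p_pr sqr_iota p4 sqr_j two_neq0 zeta_p zeta_neq1.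
rewrite -/c -/c' in GG G4.
rewrite (jacobi_sqr p_pr sqr_iota p4 nw w0 w2) in G4.
set G := gauss_sum zeta c in GG G4; set G' := gauss_sum zeta c' in GG.
pose A := gmap j w; pose B := gmap j (gconj w).
have AB : A * B = p%:R by rewrite gmap_norm // nw.
have : A * B != 0 by rewrite AB.
rewrite mulf_eq0 negb_or => /andP[A0 B0].
rewrite gmapX // -/A -AB in G4.
have {}G4 : G ^+ 4 = A ^+ 3 * B by rewrite G4; ring.
have cN1 : c (-1) != 0.
  apply/eqP => e; have := cc' (-1); rewrite -/(c _) e mul0r oppr_eq0 oner_eq0.
  by move/esym/eqP; rewrite oner_eq0.
have G0 : G != 0.
  have : G * G' != 0 by rewrite GG mulf_neq0.
  by rewrite mulf_eq0 negb_or => /andP[].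
have hA := frob_j (gre w)%:~R (gim w)%:~R.
rewrite !rmorph_int in hA.
have eA : (gre w)%:~R + (gim w)%:~R * j = A by [].
have eB : (gre w)%:~R - (gim w)%:~R * j = B.
  by rewrite /B /gmap gre_conj gim_conj rmorphN mulNr.
rewrite eA eB in hA.
suff h : c (if (q %% 4 == 1)%N then q%:R else - q%:R) =
    (if (q %% 4 == 1)%N then A / B else B / A) ^+ M.
  rewrite /qchar /torus_char /torus !rmorph_int eA eB -h /c nu_gmap //.
  exact: nu_gunits.
have := q4; case: eqP cF hA => [e cF hA _|_ cF hA /= /eqP e].
  have := gauss_frob p_pr zeta_p chK qF cM cF; rewrite -/G => h.
  have M4 : (q = (4 * M).+1)%N by clear -e q_gt2; lia.
  have A4 : A ^+ (4 * M) = 1 by apply: (mulfI A0); rewrite -exprS -M4 mulr1.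
  have {}h : G ^+ (4 * M) * c q%:R = 1.
    by apply: (mulfI G0); rewrite mulrA -exprS -M4 h mulr1.
  rewrite exprM G4 in h.
  have AB0 : (A ^+ 3 * B) ^+ M != 0 by rewrite expf_neq0 ?mulf_neq0 ?expf_neq0.
  apply: (mulfI AB0); rewrite h -exprMn.
  have -> : A ^+ 3 * B * (A / B) = A ^+ 4 by field.
  by rewrite -exprM A4.
have := gauss_frob p_pr zeta_p chK qF c'M cF; rewrite -/G -/G' => h.
have M4 : (q.+1 = 4 * M)%N by clear -e q_gt2; lia.
have {}h : G ^+ (4 * M) = c (- q%:R) * (A * B).
  have cq : c q%:R * c' q%:R = 1 by have := cc' q%:R; rewrite qF.
  have cN : c (- q%:R) = c (-1) * c q%:R by rewrite -cM mulN1r.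
  rewrite -M4 exprSr -[G ^+ q]mulr1 -cq cN AB.
  have -> : G ^+ q * (c q%:R * c' q%:R) * G = c q%:R * (G * (G ^+ q * c' q%:R)) by ring.
  rewrite h.
  rewrite GG.
  change (c q%:R * (c (-1) * p%:R) = c (-1) * c q%:R * p%:R).
  by move: (c q%:R) (c (-1)) => x y; rewrite mulrA (mulrC x).
rewrite exprM G4 in h.
have AB0 : A * B != 0 by rewrite mulf_neq0.
apply: (mulIf AB0); rewrite -h.
have -> : (A ^+ 3 * B) ^+ M = (A ^+ 4 * (B / A)) ^+ M by congr (_ ^+ _); field.
by rewrite exprMn -exprM -M4 exprSr hA; ring.
Qed.

End Reciprocity.

End TorusCharacter.

(** * Values of the quartic symbol *)

Lemma Fp_sqrN1_mod4 (p : nat) (iota : 'F_p) :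
  prime p -> odd p -> iota ^+ 2 = -1 -> (p %% 4 = 1)%N.
Proof.
move=> p_pr p_odd hi; have [//|p4] : (p %% 4 = 1 \/ p %% 4 = 3)%N.
  by clear -p_odd; lia.
by have := Fp_no_sqrN1 iota p_pr p4; rewrite hi eqxx.
Qed.

(** In p = a^2 + b^2 the coordinate b is prime to p, as otherwise p^2 would divide p; [iota] is
    -a/b. *)
Lemma exists_gmap0 (p : nat) (w : gint) : prime p -> gint_norm w = p ->
  exists2 iota : 'F_p, iota ^+ 2 = -1 & gmap iota w = 0.
Proof.
move=> p_pr nw.
have e : ((gre w)%:~R ^+ 2 + (gim w)%:~R ^+ 2 = 0 :> 'F_p).
  by rewrite -!rmorphXn -rmorphD -gint_normE nw /= -pmulrn pchar_Fp_0.
have b0 : (gim w)%:~R != 0 :> 'F_p.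
  apply/eqP => b0; move/eqP: e; rewrite b0 expr0n addr0 sqrf_eq0 Fp_int_eq0 //.
  move/eqP: b0; rewrite -[_ == 0]/(_ == 0 :> 'F_p) Fp_int_eq0 //.
  move=> /dvdzP[b hb] /dvdzP[a ha]; have := gint_normE w; rewrite nw ha hb => h.
  have {}h : (p%:Z %| 1)%Z.
    apply/dvdzP; exists (a ^+ 2 + b ^+ 2).
    have p0 : p%:Z != 0 by rewrite eqz_nat -lt0n prime_gt0.
    by apply: (mulfI p0); rewrite mulr1 {1}h; ring.
  by move: h; rewrite dvdz1 absz_nat => /eqP p1; rewrite p1 in p_pr.
exists (- (gre w)%:~R / (gim w)%:~R); last by rewrite /gmap mulrC divfK // subrr.
apply: (mulIf (expf_neq0 2 b0)); rewrite -exprMn divfK // sqrrN.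
by rewrite mulN1r; apply/eqP; rewrite -addr_eq0 e.
Qed.

Lemma gdvd_norm (w z : gint) : gdvd w z -> (gint_norm w %| gint_norm z)%N.
Proof. by case=> u ->; rewrite gint_normM dvdn_mull. Qed.

Lemma gdvd_gmap (p : nat) (iota : 'F_p) (w z : gint) :
  iota ^+ 2 = -1 -> gmap iota w = 0 -> gdvd w z -> gmap iota z = 0.
Proof. by move=> hi w0 [u ->]; rewrite gmapM // w0 mulr0. Qed.

Lemma gprime_norm_prime (p : nat) (w : gint) :
  prime p -> gint_norm w = p -> gprime w.
Proof.
move=> p_pr nw; have [iota hi w0] := exists_gmap0 p_pr nw; split.
- by move=> h; move: nw p_pr; rewrite h => <-.
- by move=> /gunitP; rewrite gunitsE nw => /eqP p1; rewrite p1 in p_pr.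
move=> z z' /(gdvd_gmap hi w0); rewrite gmapM // => /eqP; rewrite mulf_eq0.
by case/orP=> /eqP h; [left|right]; apply: (gdvd_of_gmap p_pr hi nw w0 h).
Qed.

Lemma gprime_mod4 (q : nat) : prime q -> (q %% 4 = 3)%N -> gprime q%:R.
Proof.
move=> q_pr q4; have q_odd : odd q by clear -q4; lia.
have key z : (q %| gint_norm z)%N -> gdvd q%:R z.
  move=> hq; have e : (gre z)%:~R ^+ 2 + (gim z)%:~R ^+ 2 = 0 :> 'F_q.
    rewrite -!rmorphXn -rmorphD -gint_normE /=; apply/eqP.
    by rewrite -pmulrn Fp_nat_eq0.
  have b0 : (gim z)%:~R = 0 :> 'F_q.
    apply/eqP; apply: contraT => b0.
    have /eqP[] := Fp_no_sqrN1 ((gre z)%:~R / (gim z)%:~R) q_pr q4.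
    apply: (mulIf (expf_neq0 2 b0)); rewrite -exprMn divfK //.
    by rewrite mulN1r; apply/eqP; rewrite -addr_eq0 e.
  have a0 : (gre z)%:~R = 0 :> 'F_q.
    by apply/eqP; move/eqP: e; rewrite b0 expr0n addr0 sqrf_eq0.
  move/eqP: a0; move/eqP: b0; rewrite !Fp_int_eq0 //.
  move=> /dvdzP[b hb] /dvdzP[a ha]; exists (Gint a b).
  by apply: gint_ext; rewrite ?ha ?hb !gintE /=; ring.
split.
- move=> h; have := gint_norm_nat q; rewrite h; case: q q_pr {q4 q_odd key h} => //.
- move=> /gunitP; rewrite gunitsE gint_norm_nat -{2}(exp1n 2) eqn_exp2r //.
  by move/eqP => q1; rewrite q1 in q_pr.
move=> z w /gdvd_norm; rewrite gint_norm_nat gint_normM => h.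
have : (q %| gint_norm z * gint_norm w)%N by apply: dvdn_trans h; rewrite dvdn_exp.
by rewrite Euclid_dvdM // => /orP[]/key; [left|right].
Qed.

Lemma gcoprime2P (z : gint) : gcoprime z 2 <-> odd (gint_norm z).
Proof.
split=> [h|o d /gdvd_norm dz /gdvd_norm].
  apply: contraT => e; have := gint_normE z => hz.
  have /gunitP : gunit (Gint 1 1).
    apply: h; last by exists (Gint 1 (-1)).
    have : (2 %| gre z + gim z)%Z by nia.
    case/dvdzP=> k hk; exists (Gint k (k - gre z)).
    by apply: gint_ext; rewrite !gintE /=; lia.
  by rewrite gunitsE.
rewrite -[2]/(2%:R) gint_norm_nat => d2; apply/gunitP; rewrite gunitsE.
have co : coprime (gint_norm d) (2 ^ 2).
  by rewrite coprimeXr // coprimen2; apply: dvdn_odd dz o.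
by rewrite -(gcdn_idPl d2).
Qed.

(** Two distinct elements of {0, 1, -1, i, -i} differ by an element of norm 1, 2 or 4, which a prime
    of odd norm cannot divide; the candidate is therefore unique. *)
Lemma quartic_primeE (z w s : gint) :
    gprime w -> gcoprime w 2%:R -> s \in 0 :: gunits ->
    gcong w s (z ^+ ((gint_norm w).-1 %/ 4)) ->
  quartic_prime z w = s.
Proof.
move=> w_pr /gcoprime2P w_odd s_mem hs; apply: xget_unique => //= s' [s'_mem hs'].
apply/eqP/negPn/negP => ss'.
have : gdvd w (s' - s).
  case: hs => u hu; case: hs' => u' hu'; exists (u' - u).
  by rewrite mulrBl -hu -hu'; ring.
move/gdvd_norm => d.
have d4 : (gint_norm w %| 2 ^ 2)%N.
  apply: dvdn_trans d _; move: ss' s_mem s'_mem; clear.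
  rewrite !inE => h /or4P[/eqP e|/eqP e|/eqP e|/orP[/eqP e|/eqP e]];
  rewrite {}e in h * => /or4P[/eqP e|/eqP e|/eqP e|/orP[/eqP e|/eqP e]];
  rewrite {}e in h * => //.
have : coprime (gint_norm w) (2 ^ 2) by rewrite coprimeXr // coprimen2.
rewrite /coprime (gcdn_idPl d4) -gunitsE.
by case: w_pr => _ nu _ /gunitP.
Qed.

Section PrimeNorm.
Variables (p : nat) (iota : 'F_p) (w : gint).
Hypotheses (p_pr : prime p) (p_odd : odd p) (sqr_iota : iota ^+ 2 = -1).
Hypotheses (nw : gint_norm w = p) (w0 : gmap iota w = 0).

Let p4 : (p %% 4 = 1)%N := Fp_sqrN1_mod4 p_pr p_odd sqr_iota.

Lemma quartic_prime_chi z : quartic_prime z w = chi iota (gmap iota z).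
Proof.
apply: quartic_primeE.
- exact: gprime_norm_prime nw.
- by apply/gcoprime2P; rewrite nw.
- exact: nu_gunits.
- apply: (gdvd_of_gmap p_pr sqr_iota nw w0).
  by rewrite gmapB (gmap_chi p_pr sqr_iota p4) gmapX // nw subrr.
Qed.

End PrimeNorm.

(** Every factorization of an element of prime norm p consists of a unit and one prime of norm p,
    which reduces to 0 under the same [iota] as w; so all factorizations give the same value. *)
Lemma quartic_chi (p : nat) (iota : 'F_p) (w z : gint) :
    prime p -> odd p -> iota ^+ 2 = -1 -> gint_norm w = p -> gmap iota w = 0 ->
  quartic z w = chi iota (gmap iota z).
Proof.
move=> p_pr p_odd hi nw w0; apply: xget_unique => /=.
  exists 1, [:: w]; split.
  - exact/gunitP.
  - move=> w'; rewrite inE => /eqP->; split; first exact: gprime_norm_prime nw.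
    by apply/gcoprime2P; rewrite nw.
  - by rewrite big_seq1 mul1r.
  - by rewrite big_seq1 (quartic_prime_chi p_pr p_odd hi nw w0).
move=> s [u [ps [/gunitP hu hps hw ->]]].
have n1 v : v \in ps -> gint_norm v != 1%N.
  move=> /hps[[_ nuv _] _]; rewrite -gunitsE; apply/negP => h.
  by apply: nuv; apply/gunitP.
have := congr1 gint_norm hw; rewrite nw gint_normM gint_norm_prod.
move: hu; rewrite gunitsE => /eqP nu1; rewrite nu1 mul1n.
case: ps hps hw n1 => [|v ps] hps hw n1; first by rewrite big_nil => p1; rewrite p1 in p_pr.
rewrite big_cons => hp.
have nv : gint_norm v = p.
  have /primeP[_ /(_ (gint_norm v))] := p_pr; rewrite {1}hp dvdn_mulr //.
  move=> /(_ isT)/orP[|/eqP//]; by rewrite (negPf (n1 _ (mem_head _ _))).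
have {hp} : (\prod_(j <- ps) gint_norm j = 1)%N.
  by move/eqP: hp; rewrite nv -{1}[p]muln1 eqn_mul2l eqn0Ngt prime_gt0 // eq_sym => /eqP.
case: ps hps hw n1 => [|v' ps] hps hw n1; last first.
  rewrite big_cons => /eqP; rewrite muln_eq1 => /andP[h _].
  by have := n1 v'; rewrite !inE eqxx orbT h => /(_ isT).
move=> _; rewrite big_seq1 in hw; rewrite big_seq1.
apply: quartic_prime_chi => //; move: w0; rewrite hw gmapM // => /eqP.
rewrite mulf_eq0 => /orP[/eqP|/eqP//] h.
have := gmap_norm hi u; rewrite h mul0r nu1 => /esym/eqP.
by rewrite oner_eq0.
Qed.

Lemma odd_gint_norm_mod4 (z : gint) : odd (gint_norm z) -> (gint_norm z %% 4 = 1)%N.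
Proof.
have half (x : int) : exists y, x = 2 * y \/ x = 2 * y + 1.
  by exists (x %/ 2)%Z; lia.
move=> o; have := gint_normE z.
have [a ha] := half (gre z); have [b hb] := half (gim z).
have -> : gre z ^+ 2 + gim z ^+ 2 = (gre z - 2 * a) ^+ 2 + (gim z - 2 * b) ^+ 2
  + 4 * (a * (gre z - a) + b * (gim z - b)) by ring.
set c := a * _ + _; case: ha => ->; case: hb => ->; lia.
Qed.

Lemma gi_expr_mod4 (m n : nat) : m = n %[mod 4] -> gi ^+ m = gi ^+ n.
Proof.
have h k : gi ^+ k = gi ^+ (k %% 4).
  by rewrite {1}(divn_eq k 4) exprD mulnC exprM gunits4 // expr1n mul1r.
by move=> e; rewrite h e -h.
Qed.

(** For m = 4a + 1 and n = 4b + 1, (mn - 1)/4 = 4ab + a + b. *)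
Lemma gi_expr_predM (m n : nat) : (m %% 4 = 1)%N -> (n %% 4 = 1)%N ->
  gi ^+ ((m * n).-1 %/ 4) = gi ^+ (m.-1 %/ 4) * gi ^+ (n.-1 %/ 4).
Proof.
move=> hm hn; rewrite -exprD; apply: gi_expr_mod4.
rewrite (divn_eq m 4) (divn_eq n 4) hm hn.
have -> : (((m %/ 4 * 4 + 1) * (n %/ 4 * 4 + 1)).-1 %/ 4 =
          m %/ 4 * (n %/ 4) * 4 + (m %/ 4 + n %/ 4))%N by nia.
rewrite modnMDl; congr (_ %% _)%N; lia.
Qed.

Lemma gi_expr_gunits k : gi ^+ k \in gunits.
Proof. by elim: k => [//|k IHk]; rewrite exprS gunitsM. Qed.

Lemma quartic_prime_gi (k : nat) (w : gint) : gprime w -> gcoprime w 2%:R ->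
  quartic_prime (gi ^+ k) w = gi ^+ (k * ((gint_norm w).-1 %/ 4)).
Proof.
move=> h1 h2; apply: quartic_primeE => //; first by rewrite in_cons gi_expr_gunits orbT.
by rewrite /gcong exprM subrr; exists 0; rewrite mul0r.
Qed.

Lemma prod_quartic_prime_gi (k : nat) (ps : seq gint) :
    (forall w, w \in ps -> gprime w /\ gcoprime w 2%:R) ->
  \prod_(w <- ps) quartic_prime (gi ^+ k) w =
     gi ^+ (k * ((gint_norm (\prod_(w <- ps) w)).-1 %/ 4)) /\
  odd (gint_norm (\prod_(w <- ps) w)).
Proof.
elim: ps => [|w ps IHps] hps; first by rewrite !big_nil muln0.
have [h1 h2] := hps w (mem_head _ _).
have /IHps[IH o] : forall v, v \in ps -> gprime v /\ gcoprime v 2%:R.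
  by move=> v hv; apply: hps; rewrite inE hv orbT.
have /gcoprime2P o' := h2.
rewrite !big_cons quartic_prime_gi // IH gint_normM oddM o o'; split=> //.
by rewrite !(mulnC k) !exprM gi_expr_predM ?odd_gint_norm_mod4 // exprMn.
Qed.

(** Existence of a factorization keeps [quartic] with denominator w from being the default 0. *)
Definition gfactored (w : gint) : Prop := exists (u : gint) (ps : seq gint),
  [/\ gunit u, forall v, v \in ps -> gprime v /\ gcoprime v 2%:R &
      w = u * \prod_(v <- ps) v].

(** When the numerator is a power of i, every factorization yields a value that depends only on
    N(w). *)
Lemma quartic_gi (k : nat) (w : gint) : gfactored w ->
  quartic (gi ^+ k) w = gi ^+ (k * ((gint_norm w).-1 %/ 4)).
Proof.
move=> [u [ps [hu hps hw]]].
have key u' ps' : gunit u' ->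
    (forall v, v \in ps' -> gprime v /\ gcoprime v 2%:R) ->
    w = u' * \prod_(v <- ps') v ->
    \prod_(v <- ps') quartic_prime (gi ^+ k) v =
    gi ^+ (k * ((gint_norm w).-1 %/ 4)).
  move=> /gunitP hu' hps' hw'; have [-> _] := prod_quartic_prime_gi k hps'.
  by move: hu'; rewrite hw' gint_normM gunitsE => /eqP->; rewrite mul1n.
apply: xget_unique => /=.
  by exists u, ps; split=> //; rewrite (key _ _ hu hps hw).
by move=> s [u' [ps' [hu' hps' hw' ->]]]; apply: key hw'.
Qed.

Lemma gfactoredM (w z : gint) : gfactored w -> gfactored z -> gfactored (w * z).
Proof.
move=> [u [ps [/gunitP hu hps ->]]] [v [qs [/gunitP hv hqs ->]]].
exists (u * v), (ps ++ qs); split; first by apply/gunitP; rewrite gunitsM.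
  by move=> x; rewrite mem_cat => /orP[/hps|/hqs].
by rewrite big_cat /= mulrACA.
Qed.

Lemma gfactored1 : gfactored 1.
Proof. by exists 1, [::]; split=> //; [apply/gunitP|rewrite big_nil mulr1]. Qed.

Lemma gfactored_prime (v : gint) : gprime v -> gcoprime v 2%:R -> gfactored v.
Proof.
move=> h1 h2; exists 1, [:: v]; split; first exact/gunitP.
  by move=> x; rewrite inE => /eqP->.
by rewrite big_seq1 mul1r.
Qed.

(** For q = 1 mod 4 the Jacobi sum supplies the splitting q = J conj J; for q = 3 mod 4, q is itself
    a Gaussian prime. *)
Lemma gfactored_odd_prime (q : nat) : prime q -> odd q -> gfactored q%:R.
Proof.
move=> q_pr q_odd; have [q4|q4] : (q %% 4 = 1 \/ q %% 4 = 3)%N by clear -q_odd; lia.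
  have [iota hi] := Fp_exists_sqrN1 q_pr q4.
  have nJ := gint_norm_jacobi q_pr hi q4; have := mul_gconj (jacobi iota).
  rewrite nJ => <-; have nJ' : gint_norm (gconj (jacobi iota)) = q.
    by apply: etrans nJ; apply: (can_inj absz_nat); rewrite !gint_normE !gintE sqrrN.
  apply: gfactoredM; apply: gfactored_prime; try exact: (@gprime_norm_prime q);
    by apply/gcoprime2P; rewrite ?nJ ?nJ'.
apply: gfactored_prime; first exact: gprime_mod4.
by apply/gcoprime2P; rewrite gint_norm_nat oddX q_odd.
Qed.

Lemma gfactored_nat (n : nat) : odd n -> gfactored n%:R.
Proof.
have [m] := ubnP n; elim: m n => // m IHm n; rewrite ltnS => nm n_odd.
have [n1|n1] := leqP n 1.
  by have -> : n = 1%N; [clear -n1 n_odd; lia | exact: gfactored1].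
have q_pr := pdiv_prime n1; have qn := pdiv_dvd n.
rewrite -(divnK qn) natrM; apply: gfactoredM.
  apply: IHm; last by apply: dvdn_odd n_odd; rewrite dvdn_div.
  by apply: leq_trans nm; rewrite ltn_Pdiv ?prime_gt1 ?(ltn_trans _ n1).
by apply: gfactored_odd_prime => //; apply: dvdn_odd n_odd.
Qed.

(** * Periodic sums *)

Lemma Fp_sum_nat (q : nat) (V : nmodType) (F : 'F_q -> V) : prime q ->
  \sum_(0 <= n < q) F n%:R = \sum_(b : 'F_q) F b.
Proof.
move=> q_pr; transitivity (\sum_(b : 'F_q) F (b : nat)%:R).
  by rewrite -(big_mkord xpredT (fun n => F n%:R)) Fp_cast.
by apply: eq_bigr => b _; rewrite natr_Zp.
Qed.

(** Any root of 1 + X + ... + X^(p - 1) works, since this polynomial takes the value p at 1. *)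
Lemma closed_char_unity_root (K : closedFieldType) (p : nat) :
  (1 < p)%N -> p%:R != 0 :> K -> exists2 z : K, z ^+ p = 1 & z != 1.
Proof.
move=> p1 p0; pose P : {poly K} := \poly_(i < p) 1.
have sP : size P = p.
  by apply: size_poly_eq; rewrite oner_neq0.
have [z] : exists z, root P z by apply/closed_rootP; rewrite sP; lia.
move/rootP; rewrite horner_poly; under eq_bigr do rewrite mul1r.
move=> z0; exists z.
  by apply/eqP; rewrite -subr_eq0 subrX1 z0 mulr0.
apply/eqP => z1; move: z0; rewrite z1; under eq_bigr do rewrite expr1n.
by rewrite sumr_const card_ord => /eqP; rewrite (negPf p0).
Qed.

Lemma closed_sqrN1 (K : closedFieldType) : exists j : K, j ^+ 2 = -1.
Proof.
have [j] := @solve_monicpoly K 2 (fun i => if i == 0%N then -1 else 0) isT.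
by rewrite !big_ord_recl big_ord0 /= mul0r !addr0 mulr1 => h; exists j.
Qed.

(** For an odd prime q, the number of b modulo q with 1 + b^2 != 0, that is q - 1 - (-1/q): the
    denominator in [Omega1]. *)
Definition torus_card (q : nat) : nat := if (q %% 4 == 1)%N then (q - 2)%N else q.

(** An interface that forgets the field behind X_q, which changes with q. [qc_sum] sums along the
    line of real part s, where the trace condition places pi up to a unit. *)
Record quartic_character (q : nat) (X : gint -> gint) : Prop := {
  qcM : forall z w, X (z * w) = X z * X w;
  qc_period : forall z w, X (z + q%:R * w) = X z;
  qc_gunits0 : forall z, X z \in 0 :: gunits;
  qc_eq0 : forall z, (X z == 0) = (q %| gint_norm z)%N;
  qc_gi : X gi = (-1) ^+ (q.+1 %/ 4);
  qc_sum : forall (s : int) (m : nat), (0 < m)%N ->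
    \sum_(0 <= n < q) X (Gint s n) ^+ m =
      if (q%:Z %| s)%Z then q.-1%:R * X gi ^+ m
      else if (4 %| m)%N then (torus_card q)%:R else - X gi ^+ m;
  qc_reciprocity : forall (p : nat) (iota : 'F_p) (w : gint),
    prime p -> odd p -> p != q -> iota ^+ 2 = -1 -> gint_norm w = p ->
    gmap iota w = 0 -> (2 %| gim w)%Z ->
    chi iota (if (q %% 4 == 1)%N then q%:R else - q%:R) = X w }.

Lemma exists_quartic_character (q : nat) : prime q -> odd q ->
  exists X, quartic_character q X.
Proof.
move=> q_pr q_odd.
have [K [f _]] := countable_algebraic_closure 'F_q.
have [j hj] := closed_sqrN1 K.
have qF : q%:R = 0 :> 'F_q by rewrite pchar_Fp_0.
exists (qchar f j); split.
- exact: qcharM.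
- move=> z w; rewrite /qchar !gintE !mul0r addr0 subr0 !rmorphD !rmorphM /=.
  by rewrite -!pmulrn qF !mul0r !addr0.
- by move=> z; apply: torus_char_gunits0.
- move=> z; rewrite torus_char_eq0 // -!rmorphXn -rmorphD -gint_normE /=.
  by rewrite -pmulrn Fp_nat_eq0.
- by rewrite /qchar torus_char01.
- move=> s m m0; rewrite -Fp_int_eq0 // /qchar /=.
  rewrite (Fp_sum_nat (fun b => torus_char f j s%:~R b ^+ m)) //.
  case: eqP => [->|/eqP s0]; first by rewrite sum_torus_char0.
  rewrite sum_torus_char_scale //; case: ifP => m4; first by rewrite sum_torus_char_dvd4.
  by rewrite sum_torus_char_ndvd4 ?m4.
move=> p iota w p_pr p_odd pq hi nw w0 w2.
have pK : p%:R != 0 :> K.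
  rewrite -(rmorph_nat f) fmorph_eq0 Fp_nat_eq0 // dvdn_prime2 // eq_sym //.
have [zeta h1 h2] := closed_char_unity_root (prime_gt1 p_pr) pK.
by apply: (qchar_reciprocity q_pr q_odd f hj p_pr _ hi h1 h2) => //; apply: Fp_sqrN1_mod4 hi.
Qed.

Section PeriodicSums.
Variable V : comPzRingType.
Implicit Types f g : nat -> V.

Definition periodic (q : nat) f := forall n, f (n + q)%N = f n.

Lemma periodic_modn q f n : periodic q f -> f (n %% q)%N = f n.
Proof.
move=> hf; rewrite {2}(divn_eq n q) addnC; elim: (n %/ q)%N => [|k IHk].
  by rewrite addn0.
by rewrite mulSn addnCA addnC hf.
Qed.

Lemma sum_periodic_mul q k f : periodic q f ->
  \sum_(0 <= n < k * q) f n = k%:R * \sum_(0 <= n < q) f n.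
Proof.
move=> hf; elim: k => [|k IHk]; first by rewrite mul0n mul0r big_geq.
rewrite mulSn addnC (@big_cat_nat _ _ _ (k * q)) ?leq_addr //= IHk.
rewrite -natr1 mulrDl mul1r; congr (_ + _).
rewrite -{1}[(k * q)%N]add0n big_addn addKn; apply: eq_big_nat => n _.
by rewrite -[LHS](periodic_modn _ hf) addnC modnMDl periodic_modn.
Qed.

Lemma sum_crt a b f g : coprime a b -> (0 < a)%N -> (0 < b)%N ->
    periodic a f -> periodic b g ->
  \sum_(0 <= n < a * b) f n * g n =
  (\sum_(0 <= n < a) f n) * (\sum_(0 <= n < b) g n).
Proof.
move=> co a0 b0 hf hg; rewrite !big_mkord big_distrlr pair_big /=.
pose h (n : 'I_(a * b)) : 'I_a * 'I_b :=
  (Ordinal (ltn_pmod n a0), Ordinal (ltn_pmod n b0)).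
have h_inj : injective h.
  move=> m n [em en]; apply/val_inj => /=.
  have : (m == n %[mod a * b])%N by rewrite chinese_remainder // em en !eqxx.
  by rewrite !modn_small // => /eqP.
have h_bij : bijective h by apply: inj_card_bij; rewrite ?card_prod ?card_ord.
rewrite [RHS](reindex h); last exact: onW_bij.
by apply: eq_bigr => n _; rewrite /h /= !periodic_modn.
Qed.

Lemma periodic_prod (ps : seq nat) (e : nat -> nat) (F : nat -> nat -> V) :
    (forall q, q \in ps -> (0 < e q)%N /\ periodic q (F q)) ->
  periodic (\prod_(q <- ps) q ^ e q) (fun n => \prod_(q <- ps) F q n).
Proof.
move=> hF n; rewrite big_seq [RHS]big_seq; apply: eq_bigr => q hq.
have [e0 per] := hF q hq; rewrite -[LHS](periodic_modn _ per).
rewrite -[RHS](periodic_modn _ per); congr (F q _).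
rewrite -modnDmr (_ : (\prod_(q <- ps) q ^ e q) %% q = 0)%N ?addn0 //.
by apply/eqP; rewrite -/(dvdn _ _) (big_rem q) //= dvdn_mulr // dvdn_exp.
Qed.

(** Chinese remainder theorem; [F q] has period q while the modulus contains q^e, whence q^(e - 1)
    repetitions. *)
Lemma sum_prod_periodic (ps : seq nat) (e : nat -> nat) (F : nat -> nat -> V) :
    uniq ps -> (forall q, q \in ps -> prime q) ->
    (forall q, q \in ps -> (0 < e q)%N /\ periodic q (F q)) ->
  \sum_(0 <= n < \prod_(q <- ps) q ^ e q) \prod_(q <- ps) F q n =
  \prod_(q <- ps) ((q ^ (e q).-1)%:R * \sum_(0 <= n < q) F q n).
Proof.
elim: ps => [|q ps IHps] /=; first by rewrite !big_nil big_nat1 big_nil.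
move=> /andP[qps ups] ps_pr hF; have q_pr := ps_pr q (mem_head _ _).
have [e0 per] := hF q (mem_head _ _).
have hF' v : v \in ps -> (0 < e v)%N /\ periodic v (F v).
  by move=> hv; apply: hF; rewrite inE hv orbT.
have ps_pr' v : v \in ps -> prime v by move=> hv; apply: ps_pr; rewrite inE hv orbT.
rewrite !big_cons; under eq_bigr do rewrite big_cons.
have co : coprime (q ^ e q) (\prod_(v <- ps) v ^ e v).
  rewrite coprimeXl //; rewrite big_seq; elim/big_rec: _ => [|v x hv hx].
    by rewrite coprimen1.
  rewrite coprimeMr hx andbT coprimeXr // prime_coprime // dvdn_prime2 ?(ps_pr' v) //.
  by apply/eqP => qv; rewrite qv hv in qps.
rewrite (sum_crt (f := F q) (g := fun n => \prod_(v <- ps) F v n)) //; last exact: periodic_prod.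
- rewrite IHps //; congr (_ * _); rewrite -[e q]prednK //.
  by rewrite expnSr sum_periodic_mul.
- by rewrite expn_gt0 prime_gt0.
- by rewrite big_seq prodn_cond_gt0 // => v hv; rewrite expn_gt0 prime_gt0 ?ps_pr'.
move=> n; rewrite -[LHS](periodic_modn _ per) -[RHS](periodic_modn _ per).
by rewrite -modnDmr -[e q]prednK // expnS modnMr addn0.
Qed.

End PeriodicSums.

(** * The character attached to alpha *)

Lemma prod_primes_logn (n : nat) : (0 < n)%N -> (\prod_(q <- primes n) q ^ logn q n)%N = n.
Proof. by move=> n0; rewrite [RHS]prod_prime_decomp // prime_decompE big_map. Qed.

Lemma prime_odd_mem (n q : nat) : odd n -> q \in primes n -> prime q /\ odd q.
Proof.
by move=> o; rewrite mem_primes => /and3P[-> _ qn]; split=> //; apply: dvdn_odd qn o.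
Qed.

Lemma odd_sqr_mod4 n : odd n -> (n ^ 2 %% 4 = 1)%N.
Proof.
by move=> o; rewrite -modnXm; have [->|->] : (n %% 4 = 1 \/ n %% 4 = 3)%N by lia.
Qed.

Lemma gi_expr_sqr_prod (r : seq nat) (e : nat -> nat) :
    (forall q, q \in r -> odd q) ->
  gi ^+ (((\prod_(q <- r) q ^ e q)%N ^ 2).-1 %/ 4) =
  \prod_(q <- r) (gi ^+ ((q ^ 2).-1 %/ 4)) ^+ e q.
Proof.
move=> ho.
suff : gi ^+ (((\prod_(q <- r) q ^ e q)%N ^ 2).-1 %/ 4) =
  \prod_(q <- r) (gi ^+ ((q ^ 2).-1 %/ 4)) ^+ e q /\ odd (\prod_(q <- r) q ^ e q).
  by case.
elim: r ho => [|q r IHr] ho; first by rewrite !big_nil.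
have q_odd := ho q (mem_head _ _).
have /IHr[IH o] : forall v, v \in r -> odd v by move=> v hv; apply: ho; rewrite inE hv orbT.
rewrite !big_cons oddM o andbT oddX q_odd orbT; split=> //.
rewrite -IH expnMn gi_expr_predM ?odd_sqr_mod4 ?oddX ?q_odd ?orbT //; congr (_ * _).
elim: (e q) => [|k IHk]; first by rewrite exp1n expr0.
by rewrite (expnS q k) expnMn gi_expr_predM ?odd_sqr_mod4 ?oddX ?q_odd ?orbT // IHk (exprS _ k).
Qed.

(** (q^2 - 1)/4 is congruent modulo 4 to twice the integer part of (q + 1)/4. This matches the
    quartic symbol of i modulo q with X_q(i). *)
Lemma gi_expr_odd_sqr (q : nat) : odd q ->
  gi ^+ ((q ^ 2).-1 %/ 4) = (-1) ^+ (q.+1 %/ 4).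
Proof.
move=> o; rewrite -sqr_gi -exprM; apply: gi_expr_mod4.
have [e|e] : (q %% 4 = 1 \/ q %% 4 = 3)%N by lia.
  rewrite (divn_eq q 4) e; set k := (q %/ 4)%N.
  have -> : (((k * 4 + 1) ^ 2).-1 %/ 4 = k * k * 4 + 2 * k)%N by rewrite -mulnn; nia.
  rewrite modnMDl; congr (_ %% _)%N; lia.
rewrite (divn_eq q 4) e; set k := (q %/ 4)%N.
have -> : (((k * 4 + 3) ^ 2).-1 %/ 4 = (k * k + k) * 4 + 2 * (k + 1))%N by rewrite -mulnn; nia.
rewrite modnMDl; congr (_ %% _)%N; lia.
Qed.

Lemma gunits0X (v : gint) n : v \in 0 :: gunits -> v ^+ n \in 0 :: gunits.
Proof. by move=> hv; elim: n => [//|n IHn]; rewrite exprS gunits0M. Qed.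

(** Orthogonality for the powers of v/w, with w^-1 = w^3. The exponents of v run over 1, ..., 4
    instead of 0, ..., 3, which makes v = 0 contribute 0. *)
Lemma four_indicator (v w : gint) : v \in 0 :: gunits -> w \in gunits ->
  4%:R * (v == w)%:R = w ^+ 3 * v + w ^+ 2 * v ^+ 2 + w * v ^+ 3 + v ^+ 4.
Proof.
rewrite !inE => /or4P[|||/orP[]] /eqP-> /or4P[] /eqP->; exact/eqP.
Qed.

Section AlphaCharacter.
Variables (alpha : nat) (alpha_gt0 : (0 < alpha)%N) (alpha_odd : odd alpha).
Variable X : nat -> gint -> gint.
Hypothesis XP : forall q, prime q -> odd q -> quartic_character q (X q).

Local Notation Q := (primes alpha).

Definition alpha_char (z : gint) : gint := \prod_(q <- Q) X q z ^+ logn q alpha.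

Let Q_pr q : q \in Q -> prime q.
Proof. by case/(prime_odd_mem alpha_odd). Qed.
Let Q_odd q : q \in Q -> odd q.
Proof. by case/(prime_odd_mem alpha_odd). Qed.
Let XQ q : q \in Q -> quartic_character q (X q).
Proof. by move=> hq; apply: XP; [apply: Q_pr | apply: Q_odd]. Qed.
Let Q_logn q : q \in Q -> (0 < logn q alpha)%N.
Proof. by rewrite logn_gt0. Qed.

Lemma alpha_charM z w : alpha_char (z * w) = alpha_char z * alpha_char w.
Proof.
rewrite /alpha_char -big_split big_seq [RHS]big_seq.
by apply: eq_bigr => q /XQ h; rewrite (qcM h) exprMn.
Qed.

Lemma alpha_charX z n : alpha_char (z ^+ n) = alpha_char z ^+ n.
Proof.
elim: n => [|n IHn]; last by rewrite !exprS alpha_charM IHn.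
rewrite expr0 /alpha_char big_seq big1 // => q hq.
have h := XQ hq; have q_pr := Q_pr hq.
suff -> : X q 1 = 1 by rewrite expr1n.
have X1 : X q 1 \in gunits.
  have := qc_gunits0 h 1; rewrite in_cons (qc_eq0 h) /= dvdn1.
  by case: eqP => // q1; rewrite q1 in q_pr.
have := qcM h 1 1; rewrite mulr1 => /(congr1 (fun x => X q 1 ^+ 3 * x)).
by rewrite -exprSr mulrA -exprSr gunits4 // mul1r.
Qed.

Lemma alpha_char_gunits0 z : alpha_char z \in 0 :: gunits.
Proof.
rewrite /alpha_char big_seq; elim/big_ind: _ => //.
  by move=> x y; apply: gunits0M.
by move=> q /XQ h; apply/gunits0X/(qc_gunits0 h).
Qed.

Lemma alpha_char_eq0 z : alpha_char z != 0 -> coprime (gint_norm z) alpha.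
Proof.
apply: contraNT => nco; have [p p_pr] : exists2 p, prime p & (p %| gcdn (gint_norm z) alpha)%N.
  have g0 : (0 < gcdn (gint_norm z) alpha)%N by rewrite gcdn_gt0 alpha_gt0 orbT.
  exists (pdiv (gcdn (gint_norm z) alpha)); last exact: pdiv_dvd.
  by apply: pdiv_prime; rewrite ltn_neqAle g0 eq_sym nco.
rewrite dvdn_gcd => /andP[pz pa].
have hp : p \in Q by rewrite mem_primes p_pr alpha_gt0.
rewrite /alpha_char (big_rem p) //= (eqP (_ : X p z == 0)).
  by rewrite expr0n eqn0Ngt Q_logn // mul0r.
by rewrite (qc_eq0 (XQ hp)).
Qed.

Lemma alpha_char_period z w : alpha_char (z + alpha%:R * w) = alpha_char z.
Proof.
rewrite /alpha_char big_seq [RHS]big_seq; apply: eq_bigr => q hq; congr (_ ^+ _).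
have : (q %| alpha)%N by move: hq; rewrite mem_primes => /and3P[].
by case/dvdnP=> k ->; rewrite mulnC natrM -mulrA (qc_period (XQ hq)).
Qed.

Lemma alpha_char_gi : alpha_char gi = gi ^+ ((alpha ^ 2).-1 %/ 4).
Proof.
have := @gi_expr_sqr_prod Q (logn^~ alpha) Q_odd.
rewrite prod_primes_logn // => ->.
rewrite /alpha_char big_seq [RHS]big_seq; apply: eq_bigr => q hq.
by rewrite (qc_gi (XQ hq)) gi_expr_odd_sqr ?Q_odd.
Qed.

Lemma sqr_alpha_char_gi : alpha_char gi ^+ 2 = 1.
Proof.
by rewrite alpha_char_gi gi_expr_odd_sqr // -exprM mulnC exprM sqrrN !expr1n.
Qed.

Lemma quartic_gi_alpha : quartic gi alpha%:R = alpha_char gi.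
Proof.
have := quartic_gi 1 (gfactored_nat alpha_odd).
by rewrite expr1 mul1n gint_norm_nat alpha_char_gi.
Qed.

Lemma quartic_giN1_alpha : quartic (gi * gi) alpha%:R = 1.
Proof.
have := quartic_gi 2 (gfactored_nat alpha_odd).
rewrite expr2 gint_norm_nat => ->.
by rewrite mulnC exprM -alpha_char_gi sqr_alpha_char_gi.
Qed.

(** Up to sign, alpha is the product of the numbers +-q = 1 mod 4, with multiplicity. Reduction
    modulo 4 shows the sign to be (-1)^rho, and chi(-1) = (-1)^((p - 1)/4). If p divides alpha, both
    sides are 0. *)
Lemma quartic_alpha (rho p : nat) (w : gint) :
    (rho <= 1)%N -> (alpha%:Z = (-1) ^+ rho %[mod 4])%Z ->
    prime p -> odd p -> gint_norm w = p -> (2 %| gim w)%Z ->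
  quartic alpha%:R w = (-1) ^+ (rho * (p.-1 %/ 4)) * alpha_char w.
Proof.
move=> rho_le1 halpha p_pr p_odd nw w2.
have [iota hi w0] := exists_gmap0 p_pr nw.
have p4 := Fp_sqrN1_mod4 p_pr p_odd hi.
have cM := chiM p_pr hi p4; have cX := chiX p_pr hi p4.
rewrite (quartic_chi _ p_pr p_odd hi nw w0) gmap_nat.
have [pa|pa] := boolP (p %| alpha)%N.
  have -> : alpha%:R = 0 :> 'F_p by apply/eqP; rewrite Fp_nat_eq0.
  rewrite (chi0 p_pr hi p4); have [->|/alpha_char_eq0] := eqVneq (alpha_char w) 0.
    by rewrite mulr0.
  by rewrite nw prime_coprime // pa.
pose sg : 'F_p := \prod_(q <- Q) (if (q %% 4 == 1)%N then 1 else -1) ^+ logn q alpha.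
have sgE : sg = (-1) ^+ rho.
  (* [P x n] says that the sign x matches the class of n modulo 4; being multiplicative, it passes
     from the primes q to alpha. *)
  pose P (x : 'F_p) (n : nat) := (x = 1 /\ (n %% 4 = 1)%N) \/ (x = -1 /\ (n %% 4 = 3)%N).
  have PM x n y m : P x n -> P y m -> P (x * y) (n * m)%N.
    by case=> [[-> en]|[-> en]] [[-> em]|[-> em]]; rewrite /P -modnMm en em;
      rewrite ?mul1r ?mulr1 ?mulrN1 ?opprK; [left|right|right|left].
  have : P sg (\prod_(q <- Q) q ^ logn q alpha)%N.
    rewrite /sg !big_seq; elim/big_ind2: _ => [|x n y m|q hq]; first by left.
      exact: PM.
    have Pq : P (if (q %% 4 == 1)%N then 1 else -1) q.
      have := Q_odd hq; rewrite /P; case: eqP => [->|]; [by left|right; split=> //; lia].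
    elim: (logn q alpha) => [|k IHk]; first by left.
    by rewrite exprS expnS; apply: PM.
  rewrite prod_primes_logn //.
  case: rho rho_le1 halpha => [|[|//]] _ halpha [[-> ha]|[-> ha]] //.
    by move: halpha; rewrite expr0; lia.
  by move: halpha; rewrite expr1; lia.
have chiN1 : chi iota (-1) = (-1) ^+ (p.-1 %/ 4).
  have two0 : 2 != 0 :> 'F_p.
    by rewrite Fp_nat_eq0 // gtnNdvd //; case: (p) p_pr p_odd => [|[|[|?]]].
  rewrite /chi -[(-1 : 'F_p) ^+ _]signr_odd -[(-1 : gint) ^+ _]signr_odd.
  by case: (odd _); rewrite ?expr0 ?expr1 ?nu1 ?nuN1.
have -> : (-1) ^+ (rho * (p.-1 %/ 4)) = chi iota sg.
  by rewrite sgE cX chiN1 -exprM mulnC.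
have -> : alpha%:R = sg * \prod_(q <- Q) (if (q %% 4 == 1)%N then q%:R else - q%:R) ^+ logn q alpha :> 'F_p.
  rewrite -{1}(prod_primes_logn alpha_gt0) natr_prod /sg -big_split /=.
  apply: eq_bigr => q _; rewrite -exprMn natrX; congr (_ ^+ _).
  by case: ifP; rewrite ?mul1r // mulrNN mul1r.
rewrite cM; congr (_ * _); rewrite (big_morph _ cM (chi1 p_pr hi p4)).
rewrite /alpha_char big_seq [RHS]big_seq; apply: eq_bigr => q hq; rewrite cX; congr (_ ^+ _).
apply: (qc_reciprocity (XQ hq) p_pr) => //.
apply/eqP => pq; move: pa; rewrite pq.
by move: hq; rewrite mem_primes => /and3P[_ _ ->].
Qed.

(** The number of n modulo alpha with N(s + ni) prime to alpha, in product form: modulo q, the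
    condition is n != 0 if q divides s, and s^2 + n^2 != 0 otherwise. *)
Definition admissible_count (s : int) : nat :=
  (\prod_(q <- Q) (q ^ (logn q alpha).-1 *
     (if (q%:Z %| s)%Z then q.-1 else torus_card q)))%N.

Definition value_count (s : int) (w : gint) : nat :=
  (\sum_(0 <= n < alpha) (alpha_char (Gint s n) == w))%N.

Lemma alpha_char_periodic (V : Type) (F : gint -> V) (s : int) n :
  F (alpha_char (Gint s (n + alpha)%N)) = F (alpha_char (Gint s n)).
Proof.
rewrite -[in RHS](alpha_char_period _ gi); congr (F (alpha_char _)).
by apply: gint_ext; rewrite !gintE /= ?gre_nat ?gim_nat; lia.
Qed.

Section CharacterSums.
Variables (L : numFieldType) (j : L).
Hypothesis sqr_j : j ^+ 2 = -1.

(** Up to X_alpha(i)^m, the ratio of the m-th power sum of X_alpha to [admissible_count]. The case m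
    = 1 is Omega_4, and m = 2 is Omega_2, since 4 divides 2k exactly when 2 divides k. *)
Definition omega_factor (s : int) (m : nat) : L :=
  \prod_(q <- Q | ~~ (q%:Z %| s)%Z && ~~ (4 %| logn q alpha * m)%N)
    (-1 / (torus_card q)%:R).

Lemma torus_card_gt0 q : q \in Q -> (0 < torus_card q)%N.
Proof.
move=> hq; have := Q_odd hq; have := Q_pr hq; rewrite /torus_card.
by case: q {hq} => [|[|[|q]]] // _; case: ifP => //; lia.
Qed.

Lemma sum_alpha_char (s : int) (m : nat) : (0 < m)%N ->
  gmap j (\sum_(0 <= n < alpha) alpha_char (Gint s n) ^+ m) =
  gmap j (alpha_char gi) ^+ m * (admissible_count s)%:R * omega_factor s m.
Proof.
move=> m0.
have -> : \sum_(0 <= n < alpha) alpha_char (Gint s n) ^+ m =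
  \sum_(0 <= n < \prod_(q <- Q) q ^ logn q alpha)
    \prod_(q <- Q) X q (Gint s n) ^+ (logn q alpha * m).
  rewrite prod_primes_logn //; apply: eq_bigr => n _; rewrite /alpha_char -prodrXl.
  by apply: eq_bigr => q _; rewrite exprM.
rewrite (sum_prod_periodic (F := fun q n => X q (Gint s n) ^+ (logn q alpha * m))); first last.
- move=> q hq; split; first exact: Q_logn.
  move=> n; congr (_ ^+ _); rewrite -[RHS](qc_period (XQ hq) _ gi); congr (X q _).
  by apply: gint_ext; rewrite !gintE /= ?gre_nat ?gim_nat; lia.
- exact: Q_pr.
- exact: primes_uniq.
rewrite gmap_prod // -gmapX // /alpha_char -prodrXl gmap_prod // natr_prod.
rewrite -big_split /= /omega_factor [X in _ * X]big_mkcond -big_split /=.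
rewrite big_seq [RHS]big_seq; apply: eq_bigr => q hq.
have h := XQ hq; have e0 : (0 < logn q alpha * m)%N by rewrite muln_gt0 Q_logn.
rewrite (qc_sum h) // !(gmapM sqr_j) -exprM !(gmapX sqr_j) gmap_nat natrM.
(* If 4 divides the exponent, the power of X_q(i) is therefore 1, so X_alpha(i)^m can be factored
   out uniformly in all three cases of [qc_sum]. *)
have X2 : X q gi ^+ 2 = 1 by rewrite (qc_gi h) -exprM mulnC exprM sqrrN expr1n.
case: ifP => qs /=.
  by rewrite mulr1 (gmapM sqr_j) gmap_nat (gmapX sqr_j); ring.
case: ifP => h4 /=.
  case/dvdnP: h4 => k ->; rewrite -(gmapX sqr_j) mulnC (exprM _ 4) (exprM _ 2 2) X2.
  by rewrite !expr1n gmap1 gmap_nat mul1r mulr1.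
have t0 : (torus_card q)%:R != 0 :> L by rewrite pnatr_eq0 -lt0n torus_card_gt0.
by rewrite (gmapN _ (_ ^+ _)) (gmapX sqr_j); field.
Qed.

Lemma omega_factor3 s : omega_factor s 3 = omega_factor s 1.
Proof. by apply: eq_bigl => q; rewrite muln1; congr (_ && ~~ _); lia. Qed.

Lemma omega_factor4 s : omega_factor s 4 = 1.
Proof. by apply: big1 => q; rewrite dvdn_mull // andbF. Qed.

(** In the orthogonality relation the exponent 4 gives the leading 1 and the exponent 2 the last
    term. The exponents 1 and 3 share one sum, because X_alpha(i) equals its own cube and their
    [omega_factor] agree. *)
Lemma value_countE (s : int) (w : gint) : w \in gunits ->
  (4 * value_count s w)%:R = (admissible_count s)%:R *
    (1 + (gmap j w + gmap j w ^+ 3) * gmap j (alpha_char gi) * omega_factor s 1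
       + gmap j w ^+ 2 * omega_factor s 2).
Proof.
move=> hw; rewrite -(gmap_nat j) natrM natr_sum.
have -> : 4%:R * \sum_(0 <= n < alpha) (alpha_char (Gint s n) == w)%:R =
  w ^+ 3 * \sum_(0 <= n < alpha) alpha_char (Gint s n) ^+ 1 +
  w ^+ 2 * \sum_(0 <= n < alpha) alpha_char (Gint s n) ^+ 2 +
  w * \sum_(0 <= n < alpha) alpha_char (Gint s n) ^+ 3 +
  \sum_(0 <= n < alpha) alpha_char (Gint s n) ^+ 4.
  rewrite !mulr_sumr -!big_split /=; apply: eq_bigr => n _.
  by rewrite four_indicator ?alpha_char_gunits0.
rewrite !(gmapD, gmapX sqr_j, gmapM sqr_j) !sum_alpha_char // omega_factor3 omega_factor4.
have T2 : gmap j (alpha_char gi) ^+ 2 = 1.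
  by rewrite -(gmapX sqr_j) sqr_alpha_char_gi gmap1.
set T := gmap j (alpha_char gi) in T2 *.
have T3 : T ^+ 3 = T by rewrite exprS T2 mulr1.
have T4 : T ^+ 4 = 1 by rewrite (exprM T 2 2) T2 expr1n.
by rewrite T2 T3 T4; ring.
Qed.

End CharacterSums.
End AlphaCharacter.

(** * Euler products *)

Lemma Fp_exists_sqr (p : nat) (D : int) : prime p ->
  [exists b : 'I_p, (D == (b : nat)%:Z ^+ 2 %[mod p%:Z])%Z] =
  [exists x : 'F_p, x ^+ 2 == D%:~R].
Proof.
move=> p_pr; apply/existsP/existsP => [[b]|[x /eqP hx]].
  rewrite eqz_mod_dvd -Fp_int_eq0 // rmorphB /= subr_eq0 eq_sym => /eqP h.
  by exists (b : nat)%:R; rewrite -h rmorphXn /= -pmulrn.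
have xp : (x < p)%N by rewrite -[X in (_ < X)%N](Fp_cast p_pr).
exists (Ordinal xp); rewrite eqz_mod_dvd -Fp_int_eq0 // rmorphB /= subr_eq0.
by rewrite rmorphXn /= -pmulrn natr_Zp hx.
Qed.

Lemma legendreE (p : nat) (D : int) : prime p ->
  legendre D p = if D%:~R == 0 :> 'F_p then 0
                 else if [exists x : 'F_p, x ^+ 2 == D%:~R] then 1 else -1.
Proof. by move=> p_pr; rewrite /legendre Fp_exists_sqr // Fp_int_eq0. Qed.

Lemma legendre_mul_sqr (p : nat) (D c : int) : prime p ->
  legendre (D * c ^+ 2) p = if (p%:Z %| c)%Z then 0 else legendre D p.
Proof.
move=> p_pr; rewrite !legendreE // -Fp_int_eq0 // rmorphM rmorphXn /=.
have [->|c0] := eqVneq (c%:~R : 'F_p) 0; first by rewrite expr0n mulr0 eqxx.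
rewrite mulf_eq0 sqrf_eq0 (negPf c0) orbF; case: ifP => // _; congr (if _ then _ else _).
apply/existsP/existsP => -[x /eqP hx].
  by exists (x / c%:~R); rewrite expr_div_n hx mulfK // expf_neq0.
by exists (x * c%:~R); rewrite exprMn hx.
Qed.

Lemma legendre_N1 (p : nat) : prime p -> odd p ->
  legendre (-1) p = if (p %% 4 == 1)%N then 1 else -1.
Proof.
move=> p_pr p_odd; rewrite legendreE // rmorphN rmorph1 oppr_eq0 oner_eq0.
congr (if _ then _ else _); case: eqP => [/(Fp_exists_sqrN1 p_pr)[i hi]|p4].
  by apply/existsP; exists i; rewrite hi.
apply/existsP => -[x]; apply/negP; apply: Fp_no_sqrN1 => //.
by clear -p_odd p4; lia.
Qed.

Lemma torus_cardE (R : numFieldType) (p : nat) : prime p -> odd p ->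
  (torus_card p)%:R = p%:R - 1 - (legendre (-1) p)%:~R :> R.
Proof.
move=> p_pr p_odd; rewrite legendre_N1 // /torus_card; case: ifP => _; last first.
  by rewrite rmorphN rmorph1; ring.
by rewrite natrB ?prime_gt1 // rmorph1; ring.
Qed.

Section PrimeProducts.
Local Open Scope classical_set_scope.
Local Open Scope ring_scope.
Variable R : realType.

Definition euler_factor (D : int) (p : nat) : R :=
  1 - (legendre D p)%:~R / (p%:R - 1).

Definition partial_product (D : int) (m n : nat) : R :=
  \prod_(0 <= p < n | prime p && ~~ (p %| m)%N) euler_factor D p.

Lemma euler_factorE p : prime p -> odd p ->
  euler_factor (-1) p = (torus_card p)%:R / (p.-1)%:R.
Proof.
move=> p_pr p_odd; have p0 : (p.-1)%:R != 0 :> R.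
  by rewrite pnatr_eq0 -lt0n -ltnS prednK ?prime_gt0 ?prime_gt1.
have e : p%:R - 1 = (p.-1)%:R :> R by rewrite -[in LHS](prednK (prime_gt0 p_pr)) -natr1 addrK.
by rewrite /euler_factor torus_cardE // e mulrBl divff.
Qed.

Lemma big_primes_nat (V : comPzSemiRingType) (m n : nat) (P : pred nat) (F : nat -> V) :
  (0 < m < n)%N ->
  \prod_(0 <= p < n | (p \in primes m) && P p) F p = \prod_(p <- primes m | P p) F p.
Proof.
move=> /andP[m0 mn]; rewrite -big_filter -[RHS]big_filter; apply: perm_big.
apply: uniq_perm; rewrite ?filter_uniq ?iota_uniq ?primes_uniq // => p.
rewrite !mem_filter mem_index_iota /=.
have [hp|] := boolP (p \in primes m); last by rewrite andbF.
rewrite andbT /=; suff -> : (p < n)%N by rewrite andbT.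
apply: leq_ltn_trans mn; apply: dvdn_leq => //.
by move: hp; rewrite mem_primes => /and3P[].
Qed.

(** The Euler factors of [h1] at the primes dividing alpha but not s; the product in (HL) omits them
    because alpha divides the leading coefficient. *)
Definition kappa (alpha : nat) (s : int) : R :=
  \prod_(q <- primes alpha | ~~ (q%:Z %| s)%Z) ((torus_card q)%:R / (q.-1)%:R).

Lemma kappa_neq0 alpha s : odd alpha -> kappa alpha s != 0.
Proof.
move=> o; rewrite /kappa big_seq_cond; elim/big_ind: _ => [||q /andP[hq _]].
- exact: oner_neq0.
- by move=> x y x0 y0; rewrite mulf_neq0.
have [q_pr q_odd] := prime_odd_mem o hq.
have q1 := prime_gt1 q_pr; apply: mulf_neq0; last by rewrite invr_eq0 pnatr_eq0; lia.
by rewrite pnatr_eq0 /torus_card; case: ifP; lia.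
Qed.

(** To be used with c = 32 alpha and m = 2 (16 alpha)^2. For p prime to 2 alpha, the discriminant
    -(cs)^2 has the symbol of -1 unless p divides s; then the symbol is 0 and the factor 1, which
    matches the omission of p in [h1]. The bound alpha < n brings all primes of alpha into the
    partial product. *)
Lemma partial_product_kappa (alpha : nat) (s : int) (c m : nat) (n : nat) :
    (0 < alpha)%N -> odd alpha -> (alpha < n)%N ->
    (forall p, prime p -> (p %| c)%N = (p == 2%N) || (p %| alpha)%N) ->
    (forall p, prime p -> (p %| m)%N = (p == 2%N) || (p %| alpha)%N) ->
  partial_product (-1) (2 * `|(2 * s)%R|)%N n =
  kappa alpha s * partial_product (- (c%:Z * s) ^+ 2) m n.
Proof.
move=> a0 a_odd an hc hm.
have odd_pr p : prime p -> p != 2%N -> odd p.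
  by move=> p_pr p2; case: (even_prime p_pr) => // e; rewrite e in p2.
have hs p : prime p -> p != 2%N -> (p %| 2 * `|(2 * s)%R|)%N = (p%:Z %| s)%Z.
  move=> p_pr p2; rewrite Euclid_dvdM // abszM Euclid_dvdM // dvdn_prime2 // (negPf p2).
  by rewrite dvdzE absz_nat.
rewrite /partial_product (bigID (mem (primes alpha))) /=; congr (_ * _).
  rewrite /kappa -(@big_primes_nat _ _ n) ?a0 //.
  apply: eq_big => p; last first.
    case/andP=> /andP[p_pr _] hp; have [_ p_odd] := prime_odd_mem a_odd hp.
    exact: euler_factorE.
  have [hp|_] := boolP (p \in primes alpha); last by rewrite andbF.
  have [p_pr p_odd] := prime_odd_mem a_odd hp.
  rewrite p_pr andbT hs //; by apply: contraTneq p_odd => ->.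
rewrite [LHS]big_mkcond [RHS]big_mkcond; apply: eq_bigr => p _.
have [p_pr|//] := boolP (prime p); rewrite /= mem_primes p_pr a0 /= hm //.
have [->|p2] /= := eqVneq p 2%N; first by rewrite dvdn_mulr.
rewrite hs //; have [pa|pa] /= := boolP (p %| alpha)%N; first by rewrite andbF.
rewrite andbT; have -> : - (c%:Z * s) ^+ 2 = -1 * (c%:Z * s) ^+ 2 by rewrite mulN1r.
rewrite /euler_factor legendre_mul_sqr //.
have -> : (p%:Z %| c%:Z * s)%Z = (p%:Z %| s)%Z.
  by rewrite !dvdzE abszM !absz_nat Euclid_dvdM // hc // (negPf p2) (negPf pa).
by case: (p%:Z %| s)%Z => //=; rewrite mulr0z mul0r subr0.
Qed.

(* When the sequences diverge, both [lim] are the junk value 0. *)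
Lemma lim_near_scale (u v : nat -> R) (k : R) : k != 0 ->
  (\forall n \near \oo, u n = k * v n) ->
  lim (u n @[n --> \oo]) = k * lim (v n @[n --> \oo]).
Proof.
move=> k0 uv.
have vu : \forall n \near \oo, v n = k^-1 * u n.
  by near=> n; rewrite (near uv n) // mulKf.
have cvg_near (f g : nat -> R) (l : R) : (\forall n \near \oo, g n = f n) ->
    f n @[n --> \oo] --> l -> g n @[n --> \oo] --> l.
  by move=> e; apply: cvg_trans; apply: near_eq_cvg; apply: filterS e => n ->.
have [cv|dv] := pselect (cvg (v n @[n --> \oo])).
  have hu : u n @[n --> \oo] --> k * lim (v n @[n --> \oo]).
    apply: cvg_near uv _; exact: cvgMl_tmp cv.
  by rewrite (cvg_lim _ hu).
have du : ~ cvg (u n @[n --> \oo]).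
  move=> cu; apply: dv; apply/cvg_ex; exists (k^-1 * lim (u n @[n --> \oo])).
  apply: cvg_near vu _; exact: cvgMl_tmp cu.
by rewrite (dvgP du) (dvgP dv) [point]/(0 : R) mulr0.
Unshelve. all: by end_near. Qed.

Lemma prime_product_kappa (alpha : nat) (s : int) (c m : nat) :
    (0 < alpha)%N -> odd alpha ->
    (forall p, prime p -> (p %| c)%N = (p == 2%N) || (p %| alpha)%N) ->
    (forall p, prime p -> (p %| m)%N = (p == 2%N) || (p %| alpha)%N) ->
  h1 R (2 * s) = kappa alpha s * prime_product R (- (c%:Z * s) ^+ 2) m.
Proof.
move=> a0 a_odd hc hm; rewrite /h1 dvdz_mulr //.
apply: lim_near_scale; first exact: kappa_neq0.
near=> n; apply: partial_product_kappa => //.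
by near: n; apply: nbhs_infty_gt.
Unshelve. all: by end_near. Qed.

Lemma totient_ratio (n : nat) : (0 < n)%N ->
  n%:R / (totient n)%:R = \prod_(p <- primes n) (p%:R / (p.-1)%:R) :> R.
Proof.
move=> n0; rewrite -[in n%:R](prod_primes_logn n0) totientE // !natr_prod -prodf_div.
rewrite big_seq [RHS]big_seq; apply: eq_bigr => p hp.
have e0 : (0 < logn p n)%N by rewrite logn_gt0.
have p_pr : prime p by move: hp; rewrite mem_primes => /and3P[].
have p0 : p%:R != 0 :> R by rewrite pnatr_eq0 -lt0n prime_gt0.
have -> : (p ^ logn p n)%:R = p%:R * (p ^ (logn p n).-1)%:R :> R.
  by rewrite -natrM -expnS prednK.
have q0 : (p ^ (logn p n).-1)%:R != 0 :> R by rewrite pnatr_eq0 -lt0n expn_gt0 prime_gt0.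
have p1 : (p.-1)%:R != 0 :> R by rewrite pnatr_eq0 -lt0n -ltnS prednK ?prime_gt0 ?prime_gt1.
rewrite natrM; move: (p.-1)%:R (p ^ _)%:R p1 q0 => x y x0 y0.
by field; rewrite x0 y0.
Qed.

(** Replacing q - 1 by [torus_card q] at the primes not dividing s turns phi(alpha) into
    [admissible_count]. *)
Lemma admissible_countE (alpha : nat) (s : int) : (0 < alpha)%N -> odd alpha ->
  (admissible_count alpha s)%:R = (totient alpha)%:R * kappa alpha s :> R.
Proof.
move=> a0 a_odd; rewrite /admissible_count /kappa totientE // !natr_prod.
rewrite [X in _ * X]big_mkcond -big_split /= big_seq [RHS]big_seq.
apply: eq_bigr => q hq; have [q_pr q_odd] := prime_odd_mem a_odd hq.
have q0 : (q.-1)%:R != 0 :> R.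
  by rewrite pnatr_eq0 -lt0n -ltnS prednK ?prime_gt0 ?prime_gt1.
by rewrite !natrM; case: ifP => _ /=; [ring | field].
Qed.

End PrimeProducts.

(** * Asymptotic counts *)

Section Asymptotics.
Local Open Scope classical_set_scope.
Local Open Scope ring_scope.
Variable R : realType.

(** With one constant c for all terms, the total constant vanishes only if c = 0 or the sum is
    empty, so the two readings of [asymp] never mix. *)
Lemma asymp_sum (I : eqType) (s : seq I) (F : I -> R -> R) (c : R) (G : R -> R) :
    (forall i, i \in s -> asymp (F i) c G) ->
  asymp (fun x => \sum_(i <- s) F i x) ((size s)%:R * c) G.
Proof.
move=> hF; rewrite /asymp; have [s0|s0] := eqVneq (size s) 0%N.
  rewrite s0 mul0r eqxx; exists 0; near=> x.
  by move/size0nil: s0 => ->; rewrite big_nil normr0.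
rewrite mulf_eq0 pnatr_eq0 (negPf s0) /=; case: eqP => [c0|/eqP c0].
  move: hF; rewrite /asymp c0 eqxx; elim: s {s0} => [_|i s IHs hF].
    by exists 0; near=> x; rewrite big_nil normr0.
  have [M hM] := hF i (mem_head _ _).
  have [|N hN] := IHs; first by move=> k hk; apply: hF; rewrite inE hk orbT.
  exists (M + N); near=> x; rewrite big_cons.
  apply: le_trans (ler_normD _ _) _; apply: lerD.
    by near: x.
  by near: x.
have s0' : (size s)%:R != 0 :> R by rewrite pnatr_eq0.
have h : (\sum_(i <- s) (F i x / (c * G x)) : R^o) @[x --> +oo] -->
    (\sum_(i <- s) 1 : R^o).
  elim: s {s0 s0'} hF => [_|i s IHs hF].
    by rewrite big_nil; under eq_cvg do rewrite big_nil; exact: cvg_cst.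
  rewrite big_cons; under eq_cvg do rewrite big_cons.
  apply: cvgD; last by apply: IHs => k hk; apply: hF; rewrite inE hk orbT.
  by have := hF i (mem_head _ _); rewrite /asymp (negPf c0).
have e : 1 = (size s)%:R^-1 * \sum_(i <- s) (1 : R^o) :> R^o.
  by rewrite big_const_seq count_predT iter_addr_0 mulVf.
rewrite [X in _ --> X]e.
have -> : (fun x => (\sum_(i <- s) F i x) / ((size s)%:R * c * G x) : R^o) =
   (fun x => (size s)%:R^-1 * \sum_(i <- s) (F i x / (c * G x) : R^o)).
  apply/funext => x; rewrite -mulr_suml -(mulrA (size s)%:R) invfM.
  by rewrite mulrCA.
exact: cvgMl_tmp.
Unshelve. all: by end_near. Qed.

Lemma asymp_complex (F : R -> R) (c : R) (G : R -> R) : asymp F c G ->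
  asymp (fun x => (F x)%:C) c%:C (fun x => (G x)%:C).
Proof.
have normC (z : R) : `|z%:C| = `|z|%:C by rewrite normc_def /= expr0n addr0 sqrtr_sqr.
rewrite /asymp; have -> : (c%:C == 0) = (c == 0).
  by apply/eqP/eqP => [[]//|->].
case: ifP => _.
  case=> M hM; exists M%:C; near=> x; rewrite normC lecR; by near: x.
move=> h; apply/(@cvgrPdist_lt _ (R[i])^o) => e e0.
(* Positivity in [R[i]] forces e to be real, which reduces the claim to the real limit. *)
have [er e_im] : 0 < complex.Re e /\ complex.Im e = 0.
  by move: e0; rewrite ltcE /= => /andP[/eqP -> ->].
have /cvgrPdist_lt/(_ _ er) := h; apply: filterS => x hx.
have -> : 1 - (F x)%:C / (c%:C * (G x)%:C) = (1 - F x / (c * G x))%:C.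
  by rewrite rmorphB rmorph1 fmorph_div rmorphM.
by rewrite normC (_ : e = (complex.Re e)%:C) ?ltcR //; case: (e) e_im => a b /= ->.
Unshelve. all: by end_near. Qed.

End Asymptotics.

(** The list also witnesses that A is finite, which [fset_set] requires in order not to return the
    empty set. *)
Lemma card_fset_set_seq (T : choiceType) (A : set T) (L : seq T) : uniq L ->
  (forall x, A x <-> x \in L) -> #|` fset_set A|%fset = size L.
Proof.
move=> uL hA; have -> : A = [set` [fset x in L]%fset]%classic.
  by apply/funext => x; apply/propext; rewrite /= in_fset; apply: hA.
by rewrite set_fsetK card_fseq undup_id.
Qed.

Lemma sum_blocks (V : nmodType) (K q : nat) (f : nat -> V) :
  \sum_(1 <= m < (K * q).+1) f m =
  \sum_(0 <= j < q) \sum_(1 <= k < K.+1) f (k * q - j)%N.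
Proof.
rewrite exchange_big /=; elim: K => [|K IHK]; first by rewrite mul0n !big_geq.
rewrite [RHS]big_nat_recr //= -IHK mulSn addnC -addSn.
rewrite (@big_cat_nat _ _ _ (K * q).+1) ?ltnS ?leq_addr //=; congr (_ + _).
rewrite -{1}[(K * q).+1]add0n big_addn addKn big_nat_rev /= add0n.
by apply: eq_big_nat => j hj; congr f; rewrite ?mulSn; lia.
Qed.

(** * Primes n^2 + s^2 sorted by the residue class of n *)

Section Counting.
Variables (R : realType) (s : int) (q : nat).
Hypothesis q_gt0 : (0 < q)%N.

(* The quadratic form is (q k - n0)^2 + s^2.  With k >= 1 and 0 <= n0 < q, every
   n >= 1 is q k - n0 exactly once. *)
Definition block_count (n0 : nat) : R -> nat :=
  quadratic_prime_count (q%:Z ^+ 2) (- (2 * q%:Z * n0%:Z)) (n0%:Z ^+ 2 + s ^+ 2).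

Definition good (x : R) (m : nat) : bool :=
  prime (m ^ 2 + `|s| ^ 2) && ((m ^ 2 + `|s| ^ 2)%N%:R <= x).

Lemma good_bound (x : R) (K m : nat) : x <= K%:R -> good x m -> (m <= K)%N.
Proof.
move=> xK /andP[_ h]; rewrite -(ler_nat R) (le_trans _ xK) // (le_trans _ h) //.
by rewrite ler_nat; nia.
Qed.

(** The norm at n = 0 is the square s^2; so only n > 0 and n < 0 remain. *)
Lemma good0 (x : R) : good x 0 = false.
Proof.
apply/negP => /andP[]; rewrite add0n -mulnn => /primeP[s1 hs] _.
by have /orP[/eqP|/eqP] := hs `|s|%N (dvdn_mulr _ (dvdnn _)); nia.
Qed.

Lemma block_countE (x : R) (K n0 : nat) : x <= K%:R -> (n0 < q)%N ->
  block_count n0 x = (\sum_(1 <= k < K.+2) good x (k * q - n0))%N.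
Proof.
move=> xK n0q.
pose L := [seq ((k * q - n0) ^ 2 + `|s| ^ 2)%N | k <- index_iota 1 K.+2 & good x (k * q - n0)].
have val k : (0 < k)%N -> ((k * q - n0) ^ 2 + `|s| ^ 2)%N%:Z =
    q%:Z ^+ 2 * k%:Z ^+ 2 + (- (2 * q%:Z * n0%:Z)) * k%:Z + (n0%:Z ^+ 2 + s ^+ 2).
  move=> k0; have h : (n0 <= k * q)%N by rewrite (leq_trans (ltnW n0q)) // leq_pmull.
  rewrite PoszD -!mulnn !PoszM -subzn // PoszM !abszE -normrM ger0_norm;
    last by rewrite -expr2 sqr_ge0.
  ring.
rewrite /block_count /quadratic_prime_count (@card_fset_set_seq _ _ L).
- by rewrite size_map size_filter -sum1_count big_mkcond.
- rewrite map_inj_in_uniq ?filter_uniq ?iota_uniq // => k l.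
  rewrite !mem_filter !mem_index_iota => /andP[_ /andP[k0 _]] /andP[_ /andP[l0 _]] /eqP.
  by rewrite eqn_add2r eqn_exp2r // => /eqP e; nia.
move=> p; split=> [[p_pr px [k k0 hp]]|/mapP[k]].
  have e : p = ((k * q - n0) ^ 2 + `|s| ^ 2)%N by apply: (can_inj absz_nat); rewrite val.
  have hg : good x (k * q - n0) by rewrite /good -e p_pr.
  apply/mapP; exists k => //; rewrite mem_filter hg mem_index_iota k0.
  (* With k + 1 in place of k, (k + 1)q - n0 <= K and n0 < q give kq <= K; this is why the range of
     summation extends to K + 1. *)
  have := good_bound xK hg; case: k {hp e hg} k0 => // k _; rewrite mulSn => hk.
  by rewrite !ltnS -[k]muln1; apply: leq_trans (leq_mul (leqnn k) q_gt0) _; lia.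
rewrite mem_filter mem_index_iota => /andP[/andP[p_pr px] /andP[k0 _]] ->.
by split=> //; exists k => //; apply: val.
Qed.

Lemma card_signed_count (T : choiceType) (A : set T) (F : int -> T) (P : pred int)
    (x : R) (K : nat) :
    x <= K%:R -> injective F ->
    (forall t, A t <-> exists2 n : int, t = F n & P n && good x `|n|%N) ->
  #|` fset_set A|%fset =
  (\sum_(1 <= m < K.+1) (P m%:Z && good x m) +
   \sum_(1 <= m < K.+1) (P (- m%:Z) && good x m))%N.
Proof.
move=> xK F_inj hA.
pose L1 := [seq F m%:Z | m <- index_iota 1 K.+1 & P m%:Z && good x m].
pose L2 := [seq F (- m%:Z) | m <- index_iota 1 K.+1 & P (- m%:Z) && good x m].
rewrite (@card_fset_set_seq _ _ (L1 ++ L2)).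
- rewrite size_cat !size_map !size_filter -!sum1_count.
  by rewrite [in LHS]big_mkcond [in X in (_ + X)%N = _]big_mkcond.
- rewrite cat_uniq !map_inj_in_uniq ?filter_uniq ?iota_uniq //=; last 2 first.
  + by move=> m n _ _ /F_inj /oppr_inj [].
  + by move=> m n _ _ /F_inj [].
  rewrite andbT; apply/hasPn => _ /mapP[m hm ->]; apply/negP => /mapP[n hn /F_inj e].
  move: hm hn; rewrite !mem_filter !mem_index_iota => /and3P[_ m0 _] /and3P[_ n0 _].
  by lia.
move=> t; rewrite hA mem_cat; split.
  case=> n -> /andP[hP hg].
  have n0 : n != 0 by apply: contraL hg => /eqP->; rewrite good0.
  have := good_bound xK hg; case: n n0 hP hg => n n0 hP hg nK.
    rewrite (map_f (fun m => F (Posz m))) //.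
    have hg' : good x n := hg; have nK' : (n <= K)%N := nK.
    have n0' : (n != 0)%N := n0.
    by rewrite mem_filter hP hg' mem_index_iota ltnS nK' lt0n n0'.
  apply/orP; right; rewrite NegzE (map_f (fun m => F (- m%:Z))) //.
  have hg' : good x n.+1 := hg; have nK' : (n < K)%N := nK.
  by rewrite mem_filter -NegzE hP hg' mem_index_iota !ltnS nK'.
by case/orP=> /mapP[m]; rewrite mem_filter => /andP[/andP[hP hg] _] ->;
  [exists m%:Z | exists (- m%:Z)]; rewrite // ?abszN hP.
Qed.

(** A positive n has the form qk - j and lies in the class of -j; a negative n is -(qk - j), in the
    class of j. *)
Lemma card_signed_blocks (T : choiceType) (A : set T) (F : int -> T) (P : pred int)
    (x : R) :
    injective F -> (forall n k : int, P (n + k * q%:Z) = P n) ->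
    (forall t, A t <-> exists2 n : int, t = F n & P n && good x `|n|%N) ->
  #|` fset_set A|%fset =
  (\sum_(0 <= j < q | P (- j%:Z)) block_count j x +
   \sum_(0 <= j < q | P j%:Z) block_count j x)%N.
Proof.
move=> F_inj P_per hA.
pose K0 := (Num.truncn x).+1.
have xK : x <= K0%:R by rewrite ltW // truncnS_gt.
(* K0 + 1 full blocks, to match the range of k in [block_countE]. *)
have xK' : x <= (K0.+1 * q)%N%:R.
  by rewrite (le_trans xK) // ler_nat; nia.
rewrite (card_signed_count xK' F_inj hA) !sum_blocks.
congr (_ + _)%N; rewrite [RHS]big_mkcond; apply: eq_big_nat => j /andP[_ jq];
  rewrite (block_countE xK jq).
  transitivity (\sum_(1 <= k < K0.+2) (P (- j%:Z) && good x (k * q - j)))%N.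
    apply: eq_big_nat => k /andP[k0 _]; have jk : (j <= k * q)%N by nia.
    by rewrite -subzn // PoszM addrC P_per.
  by case: (P _) => //=; rewrite big1.
transitivity (\sum_(1 <= k < K0.+2) (P j%:Z && good x (k * q - j)))%N.
  apply: eq_big_nat => k /andP[k0 _]; have jk : (j <= k * q)%N by nia.
  by rewrite -subzn // PoszM opprB -mulNr P_per.
by case: (P _) => //=; rewrite big1.
Qed.

End Counting.

(** * (HL) in one residue class *)

Section HardyLittlewoodBlocks.
Variables (R : realType) (alpha : nat) (s : int).
Hypotheses (HL : hardy_littlewood R).
Hypotheses (alpha_gt0 : (0 < alpha)%N) (alpha_odd : odd alpha) (s_neq0 : s != 0).

Local Notation q := (16 * alpha)%N.

(** The (HL) constant for the polynomial (qm - n0)^2 + s^2: here gcd(2, a + b) = 2, the root of a is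
    q, and b^2 - 4ac = -(2qs)^2, so no trace of n0 remains. *)
Definition block_const : R :=
  2 / q%:R * (alpha%:R / (totient alpha)%:R) *
  prime_product R (- ((2 * q)%N%:Z * s) ^+ 2) (2 * q ^ 2)%N.

Let q_gt0 : (0 < q)%N. Proof. by rewrite muln_gt0. Qed.

Let prime_dvd16 p : prime p -> (p %| 16)%N = (p == 2%N).
Proof. by move=> p_pr; rewrite (_ : 16 = 2 ^ 4)%N // Euclid_dvdX // dvdn_prime2 // andbT. Qed.

Let prime_dvdq p : prime p -> (p %| q)%N = (p == 2%N) || (p %| alpha)%N.
Proof. by move=> p_pr; rewrite Euclid_dvdM // prime_dvd16. Qed.

Let prime_dvd2q p : prime p -> (p %| 2 * q)%N = (p == 2%N) || (p %| alpha)%N.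
Proof. by move=> p_pr; rewrite Euclid_dvdM // dvdn_prime2 // prime_dvdq // orbA orbb. Qed.

Let prime_dvd2q2 p : prime p -> (p %| 2 * q ^ 2)%N = (p == 2%N) || (p %| alpha)%N.
Proof.
move=> p_pr; rewrite Euclid_dvdM // Euclid_dvdX // dvdn_prime2 // prime_dvdq // andbT.
by rewrite orbA orbb.
Qed.

Lemma h1_block : h1 R (2 * s) =
  kappa R alpha s * prime_product R (- ((2 * q)%N%:Z * s) ^+ 2) (2 * q ^ 2)%N.
Proof. exact: prime_product_kappa. Qed.

(** For g = gcd(a, b), which varies with n0. Its odd part keeps the primes of alpha, and
    Delta/phi(Delta) depends only on these. *)
Lemma primes_odd_part (g : nat) : (0 < g)%N -> (alpha %| g)%N -> (g %| q ^ 2)%N ->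
  primes (g`_2^')%N = primes alpha.
Proof.
move=> g0 ag gq; rewrite primes_part; apply: (irr_sorted_eq ltn_trans ltnn).
- by apply: sorted_filter; [exact: ltn_trans | exact: sorted_primes].
- exact: sorted_primes.
move=> p; rewrite mem_filter !mem_primes alpha_gt0 g0 /=.
have [p_pr|] := boolP (prime p); last by rewrite andbF.
rewrite /= !inE; have [->|p2] /= := eqVneq p 2%N.
  by apply/esym/negbTE; rewrite dvdn2 alpha_odd.
apply/idP/idP => [pg|pa]; last exact: dvdn_trans ag.
have := dvdn_trans pg gq; rewrite Euclid_dvdX // prime_dvdq // (negPf p2).
by case/andP.
Qed.

(** The discriminant is negative, hence not a square; c is odd and prime to alpha, hence prime to a
    = (16 alpha)^2. *)
Lemma asymp_block (n0 : nat) : odd (n0 ^ 2 + `|s| ^ 2) ->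
    coprime (n0 ^ 2 + `|s| ^ 2) alpha ->
  asymp (fun x : R => (block_count s q n0 x)%:R) block_const
    (fun x => Num.sqrt x / ln x).
Proof.
move=> c_odd c_co.
set a : int := q%:Z ^+ 2; set b : int := - (2 * q%:Z * n0%:Z).
set c : int := n0%:Z ^+ 2 + s ^+ 2.
have cE : `|c|%N = (n0 ^ 2 + `|s| ^ 2)%N.
  apply: (can_inj absz_nat); rewrite abszE ger0_norm ?addr_ge0 ?sqr_ge0 //.
  by rewrite PoszD -!mulnn !PoszM !abszE -normrM -!expr2 ger0_norm ?sqr_ge0.
have aE : `|a|%N = (q ^ 2)%N by rewrite abszX absz_nat.
have DE : b ^+ 2 - 4 * a * c = - ((2 * q)%N%:Z * s) ^+ 2.
  by rewrite /a /b /c (PoszM 2 q); ring.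
have a_gt0 : 0 < a by rewrite exprn_gt0.
have nsq : ~ (exists k : int, b ^+ 2 - 4 * a * c = k ^+ 2).
  case=> k; rewrite DE => /eqP; rewrite eq_sym -addr_eq0.
  rewrite paddr_eq0 ?sqr_ge0 // !sqrf_eq0 mulf_eq0 (negPf s_neq0) orbF eqz_nat.
  by rewrite muln_eq0 /= eqn0Ngt q_gt0 andbF.
have ab2 : (2 %| a + b)%Z.
  have -> : a + b = 2 * (q%:Z * (8 * alpha%:Z - n0%:Z)).
    by rewrite /a /b (PoszM 16 alpha); ring.
  by rewrite dvdz_mulr.
have co : gcdz (gcdz a b) c = 1.
  have h : coprime (q ^ 2) (n0 ^ 2 + `|s| ^ 2).
    by rewrite coprimeXl // coprimeMl -(coprime_sym _ alpha) c_co andbT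
      (coprimeXl 4 (_ : coprime 2 _)) // coprime2n.
  by rewrite /gcdz absz_nat cE aE; congr Posz; apply/eqP; apply: coprime_dvdl (dvdn_gcdl _ _) h.
have nboth : ~~ ((2 %| a + b)%Z && (2 %| c)%Z).
  by rewrite negb_and; apply/orP; right; rewrite dvdzE cE dvdn2 c_odd.
have := HL a_gt0 nsq co nboth; cbv zeta.
set Delta := (_`_ _)%N.
set C := (X in asymp _ X _); suff -> : C = block_const by [].
rewrite /C /block_const DE aE.
have -> : gcdz 2 (a + b) = 2.
  by rewrite /gcdz (gcdn_idPl _) //; move: ab2; rewrite dvdzE.
have -> : Num.sqrt a%:~R = q%:R :> R.
  by rewrite /a rmorphXn /= sqrtr_sqr -pmulrn ger0_norm.
congr (_ / _ * _ * _).
have g0 : (0 < `|gcdz a b|)%N.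
  by rewrite absz_gt0 gcdz_eq0 negb_and (gt_eqF a_gt0).
have D0 : (0 < Delta)%N by apply: part_gt0.
rewrite (totient_ratio R D0) (totient_ratio R alpha_gt0) /Delta primes_odd_part //.
  have aq : (alpha %| q)%N by rewrite dvdn_mull.
  rewrite /gcdz absz_nat dvdn_gcd aE dvdn_exp //= abszN abszM dvdn_mulr //.
  by rewrite abszM absz_nat dvdn_mull.
by rewrite /gcdz absz_nat aE dvdn_gcdl.
Qed.

End HardyLittlewoodBlocks.

(** * Counting the residue classes of n modulo 16 alpha *)

Section ResidueCount.
Variables (V : comPzRingType).

Lemma sum_int_reflect (q : nat) (f : int -> V) : (forall n, f (n + q%:Z) = f n) ->
  \sum_(0 <= j < q) f (- j%:Z) = \sum_(0 <= j < q) f j%:Z.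
Proof.
move=> per; rewrite big_nat_rev /= add0n.
transitivity (\sum_(0 <= j < q) f j.+1%:Z).
  apply: eq_big_nat => j /andP[_ jq].
  by rewrite -[LHS]per; congr f; lia.
have h : \sum_(0 <= j < q.+1) f j = \sum_(0 <= j < q) f j + f 0.
  by rewrite big_nat_recr //= -[in f q](add0r q%:Z) per.
by apply: (addIr (f 0)); rewrite -h big_nat_recl //= addrC.
Qed.

Lemma sum_residue16 (c : int) : \sum_(0 <= j < 16) (16 %| j%:Z - c)%Z%:R = 1 :> V.
Proof.
have c0 : (`|(c %% 16)%Z| < 16)%N by lia.
rewrite big_mkord (bigD1 (Ordinal c0)) //= big1 ?addr0.
  suff -> : (16 %| `|(c %% 16)%Z|%N%:Z - c)%Z by [].
  by lia.
move=> j hj; suff -> : (16 %| (j : nat)%:Z - c)%Z = false by [].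
apply/negP => h; case/eqP: hj; apply/val_inj => /=; have := ltn_ord j.
by lia.
Qed.

End ResidueCount.

Section ValueResidueCount.
Variables (R : realType) (alpha : nat).
Hypotheses (alpha_gt0 : (0 < alpha)%N) (alpha_odd : odd alpha).
Variable X : nat -> gint -> gint.
Hypothesis XP : forall q, prime q -> odd q -> quartic_character q (X q).
Variables (s c : int) (w : gint).

Definition good_residue (n : int) : bool :=
  (16 %| n - c)%Z && (alpha_char alpha X (Gint s n) == w).

Lemma good_residue_period (n k : int) :
  good_residue (n + k * (16 * alpha)%N%:Z) = good_residue n.
Proof.
rewrite /good_residue; congr (_ && _); first by lia.
have -> : Gint s (n + k * (16 * alpha)%N%:Z) =
  Gint s n + alpha%:R * ((16 * k)%:~R * gi).
  by apply: gint_ext; rewrite !gintE /=; rewrite ?PoszM; ring.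
by rewrite (alpha_char_period alpha_odd XP).
Qed.

(** One class modulo 16 combines with [value_count] classes modulo alpha by the Chinese remainder
    theorem. *)
Lemma sum_good_residue :
  \sum_(0 <= j < 16 * alpha) (good_residue j%:Z)%:R = (value_count alpha X s w)%:R :> R.
Proof.
transitivity (\sum_(0 <= j < 16 * alpha)
   ((16 %| j%:Z - c)%Z%:R * (alpha_char alpha X (Gint s j) == w)%:R) : R).
  by apply: eq_bigr => j _; rewrite /good_residue -mulnb natrM.
rewrite (sum_crt (f := fun j : nat => (16 %| j%:Z - c)%Z%:R)
  (g := fun j : nat => (alpha_char alpha X (Gint s j) == w)%:R)) //.
- by rewrite sum_residue16 mul1r natr_sum.
- by rewrite (_ : 16 = 2 ^ 4)%N // coprimeXl // coprime2n.
- by move=> n; congr (_%:R); congr (nat_of_bool _); lia.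
- by move=> n; rewrite (alpha_char_periodic alpha_gt0 alpha_odd XP (fun v => (v == w)%:R)).
Qed.

Lemma sum_good_residueN :
  \sum_(0 <= j < 16 * alpha) (good_residue (- j%:Z))%:R = (value_count alpha X s w)%:R :> R.
Proof.
rewrite -sum_good_residue.
rewrite (sum_int_reflect (f := fun n => (good_residue n)%:R)) // => n.
by rewrite -[in LHS](mul1r (16 * alpha)%N%:Z) good_residue_period.
Qed.

End ValueResidueCount.

(** * The asymptotic formula *)

Lemma gint_norm_absz (a b : int) : gint_norm (Gint a b) = (`|b| ^ 2 + `|a| ^ 2)%N.
Proof.
apply: (can_inj absz_nat); rewrite gint_normE /= PoszD -!mulnn !PoszM !abszE.
by rewrite -!normrM -!expr2 !ger0_norm ?sqr_ge0 // addrC.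
Qed.

Section SignedAsymptotics.
Variables (R : realType) (alpha : nat) (s c : int) (w : gint).
Hypotheses (HL : hardy_littlewood R).
Hypotheses (alpha_gt0 : (0 < alpha)%N) (alpha_odd : odd alpha) (s_neq0 : s != 0).
Variable X : nat -> gint -> gint.
Hypothesis XP : forall q, prime q -> odd q -> quartic_character q (X q).
Hypotheses (w_gunits : w \in gunits) (cs_odd : ~~ (2 %| c + s)%Z).

Lemma asymp_good_residue (n : int) : good_residue alpha X s c w n ->
  asymp (fun x : R => (block_count s (16 * alpha) `|n|%N x)%:R) (block_const R alpha s)
    (fun x => Num.sqrt x / ln x).
Proof.
case/andP=> hn /eqP hw; apply: asymp_block => //.
  move: cs_odd hn; clear; rewrite oddD !oddX /=; lia.
rewrite -gint_norm_absz; apply: (alpha_char_eq0 alpha_gt0 alpha_odd XP).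
by rewrite hw; apply: contraTneq w_gunits => ->.
Qed.

(** The positive and the negative n each run through [value_count] blocks, all with the same
    constant; hence the factor 2. *)
Lemma asymp_signed_count (T : choiceType) (A : R -> set T) (F : int -> T) :
    injective F ->
    (forall x t, A x t <->
       exists2 n : int, t = F n & good_residue alpha X s c w n && good s x `|n|%N) ->
  asymp (fun x : R => #|` fset_set (A x)|%fset%:R)
    ((2 * value_count alpha X s w)%N%:R * block_const R alpha s)
    (fun x => Num.sqrt x / ln x).
Proof.
move=> F_inj hA.
have q_gt0 : (0 < 16 * alpha)%N by rewrite muln_gt0.
pose P := good_residue alpha X s c w.
have P_per n k : P (n + k * (16 * alpha)%N%:Z) = P n.
  exact: good_residue_period.
pose L := [seq j <- index_iota 0 (16 * alpha) | P (- j%:Z)] ++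
          [seq j <- index_iota 0 (16 * alpha) | P j%:Z].
have -> : (fun x : R => #|` fset_set (A x)|%fset%:R) =
    (fun x => \sum_(j <- L) (block_count s (16 * alpha) j x)%:R) :> (R -> R).
  apply/funext => x; rewrite (card_signed_blocks q_gt0 F_inj P_per (hA x)).
  by rewrite /L big_cat !big_filter /= natrD !natr_sum.
have -> : (2 * value_count alpha X s w)%N%:R = (size L)%:R :> R.
  rewrite /L size_cat !size_filter -!sum1_count natrD !natr_sum.
  rewrite [X in _ = X + _]big_mkcond [X in _ = _ + X]big_mkcond /=.
  rewrite mul2n -addnn natrD.
  rewrite -{1}(sum_good_residueN R alpha_gt0 alpha_odd XP s c w).
  rewrite -(sum_good_residue R alpha_gt0 alpha_odd XP s c w).
  by congr (_ + _); apply: eq_bigr => j _; rewrite /P; case: good_residue.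
apply: asymp_sum => j; rewrite mem_cat !mem_filter => /orP[] /andP[hj _].
  by have := asymp_good_residue hj; rewrite abszN absz_nat.
by have := asymp_good_residue hj; rewrite absz_nat.
Qed.

End SignedAsymptotics.

Lemma gintC_gmap (R : realType) (z : gint) : gintC R z = gmap ('i : R[i]) z.
Proof.
by rewrite /gmap -!(rmorph_int (real_complex R)) /gintC [RHS]addrC; simpc.
Qed.

Lemma omega_factorE (R : realType) (alpha : nat) (s : int) (j m : nat) :
    odd alpha -> (forall n, (4 %| n * m)%N = (j %| n)%N) ->
  omega_factor alpha R[i] s m = (Omega1 R j alpha (2 * s))%:C.
Proof.
move=> a_odd hj; rewrite /omega_factor /Omega1 rmorph_prod /=.
rewrite big_seq_cond [RHS]big_seq_cond; apply: eq_big => q.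
  have [hq|//] := boolP (q \in primes alpha); rewrite /= hj.
  have [q_pr q_odd] := prime_odd_mem a_odd hq.
  have -> : `|(2 * s)%R|%N = (2 * `|s|)%N by rewrite abszM.
  rewrite dvdzE absz_nat Euclid_dvdM // (dvdn_prime2 q_pr (isT : prime 2)).
  by have [q2|//] := eqVneq q 2%N; rewrite q2 in q_odd.
case/andP=> hq _; have [q_pr q_odd] := prime_odd_mem a_odd hq.
by rewrite fmorph_div rmorphN1 -torus_cardE // rmorph_nat.
Qed.

Lemma gi_expr_real (d : nat) : (d <= 3)%N ->
  gi ^+ d + gi ^+ d ^+ 3 = (2 * gre (gi ^+ d))%:~R.
Proof. by case: d => [|[|[|[|//]]]] _; apply/eqP. Qed.

Lemma gi_expr_sqr (d : nat) : gi ^+ d ^+ 2 = (-1) ^+ d.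
Proof. by rewrite exprAC sqr_gi. Qed.

(** [delta] is the value of X_alpha at the unit u in pi = u(s + ni), so w is the value required of
    X_alpha(s + ni). As [delta] and the sign are their own cubes, w + w^3 = delta (-1)^(rho gamma_2)
    2 Re(i^d), and delta X_alpha(i) is the symbol of i beta. *)
Lemma block_constE (R : realType) (alpha : nat) (X : nat -> gint -> gint)
    (s : int) (rho gamma2 d : nat) (beta delta : gint) :
    (0 < alpha)%N -> odd alpha -> (d <= 3)%N ->
    (forall q, prime q -> odd q -> quartic_character q (X q)) ->
    delta \in gunits -> delta ^+ 2 = 1 ->
    delta * alpha_char alpha X gi = quartic (gi * beta) alpha%:R ->
  ((2 * value_count alpha X s (delta * ((-1) ^+ (rho * gamma2) * gi ^+ d))%R)%N%:R
     * block_const R alpha s)%:C =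
  (h1 R (2 * s) / 16)%:C * G_const R d (2 * s) alpha rho beta gamma2.
Proof.
move=> a0 a_odd d3 XP du d2 hq.
set e : gint := (-1) ^+ (rho * gamma2).
have e2 : e ^+ 2 = 1 by rewrite /e -exprM mulnC exprM sqrrN !expr1n.
set w := delta * _; pose j : R[i] := 'i%C.
have hj : j ^+ 2 = -1 by exact: sqr_i.
have eu : e \in gunits.
  by rewrite /e -signr_odd; case: odd.
have wu : w \in gunits by rewrite gunitsM // gunitsM ?gi_expr_gunits.
have w2 : gmap j w ^+ 2 = (-1) ^+ d.
  rewrite -(gmapX hj) /w !exprMn d2 e2 !mul1r gi_expr_sqr (gmapX hj).
  by rewrite gmapN gmap1.
have w3 : (gmap j w + gmap j w ^+ 3) * gmap j (alpha_char alpha X gi) =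
   2 * (gre (gi ^+ d))%:~R * (-1) ^+ (rho * gamma2) * gmap j (quartic (gi * beta) alpha%:R).
  have -> : gmap j w + gmap j w ^+ 3 = gmap j (w + w ^+ 3) by rewrite gmapD (gmapX hj).
  rewrite -hq -!(gmapM hj).
  have -> : (w + w ^+ 3) * alpha_char alpha X gi =
     (2 * gre (gi ^+ d))%:~R * e * (delta * alpha_char alpha X gi).
    rewrite -(gi_expr_real d3) /w !exprMn.
    have d3' : delta ^+ 3 = delta by rewrite exprS d2 mulr1.
    have e3 : e ^+ 3 = e by rewrite exprS e2 mulr1.
    by rewrite d3' e3; ring.
  rewrite !(gmapM hj) gmap_int /e (gmapX hj) gmapN gmap1 rmorphM /=; ring.
have := value_countE a0 a_odd XP hj s wu.
rewrite w2 w3 (omega_factorE (j := 4) R s a_odd); last by move=> n; rewrite muln1.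
rewrite (omega_factorE (j := 2) R s a_odd); last by move=> n; lia.
rewrite -gintC_gmap -[X in _ * X]/(G_const R d (2 * s) alpha rho beta gamma2).
set G := G_const _ _ _ _ _ _ _; set v := value_count _ _ _ _ => hv.
rewrite (h1_block R s a0 a_odd) /block_const.
set PP := prime_product _ _ _; set k := kappa _ _ _ in hv *.
have phi0 : (totient alpha)%:R != 0 :> R by rewrite pnatr_eq0 -lt0n totient_gt0.
have a0' : alpha%:R != 0 :> R by rewrite pnatr_eq0 -lt0n.
have hN : (admissible_count alpha s)%:R = ((totient alpha)%:R * k)%:C :> R[i].
  by rewrite -admissible_countE // rmorph_nat.
have -> : (2 * v)%N%:R * (2 / (16 * alpha)%N%:R * (alpha%:R / (totient alpha)%:R) * PP) =
  (4 * v)%N%:R * (PP / (totient alpha)%:R / 16) :> R.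
  by rewrite !natrM; field; rewrite phi0 a0'.
rewrite rmorphM /= rmorph_nat hv hN mulrAC -rmorphM; congr (_%:C * _).
by field.
Qed.

Lemma gcong16P (gamma1 gamma2 : nat) (t : gint) :
  gcong 16%:R t (2 * gamma1%:R + 1 + 2 * gamma2%:R * gi) <->
  (16 %| gre t - (2 * gamma1%:Z + 1))%Z /\ (16 %| gim t - 2 * gamma2%:Z)%Z.
Proof.
set z := _ + _ * gi.
have ez : z = Gint (2 * gamma1%:Z + 1) (2 * gamma2%:Z).
  by apply: gint_ext; rewrite /z !gintE /=; ring.
rewrite /gcong ez; split.
  case=> u hu; split; apply/dvdzP; [exists (gre u)|exists (gim u)].
    by have := congr1 gre hu; rewrite !gintE /=; lia.
  by have := congr1 gim hu; rewrite !gintE /=; lia.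
case=> /dvdzP[a ha] /dvdzP[b hb]; exists (Gint a b).
by apply: gint_ext; rewrite !gintE /=; lia.
Qed.

(** An odd square is 1 mod 8 and (2(8b + gamma_2))^2 = 4 gamma_2 mod 8, so (N(t) - 1)/4 has the
    parity of gamma_2. *)
Lemma sign_norm (rho gamma1 gamma2 : nat) (t : gint) :
    gcong 16%:R t (2 * gamma1%:R + 1 + 2 * gamma2%:R * gi) ->
  odd (gint_norm t) /\
  (-1) ^+ (rho * ((gint_norm t).-1 %/ 4)) = (-1) ^+ (rho * gamma2) :> gint.
Proof.
move=> /gcong16P[/dvdzP[a ha] /dvdzP[b hb]].
have hn := gint_normE t.
have even_pair (x : int) : exists y, x * (x + 1) = 2 * y.
  have [y [->|->]] : exists y, x = 2 * y \/ x = 2 * y + 1 by exists (x %/ 2)%Z; lia.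
    by exists (y * (2 * y + 1)); ring.
  by exists ((2 * y + 1) * (y + 1)); ring.
have [m hm] := even_pair (8 * a + gamma1%:Z).
have [l hl] := even_pair (8 * b + gamma2%:Z - 1).
have {hm hl hn} hn : (gint_norm t)%:Z = 1 + 8 * m + 4 * (2 * l + 8 * b + gamma2%:Z).
  rewrite hn.
  have -> : gre t = 2 * (8 * a + gamma1%:Z) + 1 by lia.
  have -> : gim t = 2 * (8 * b + gamma2%:Z) by lia.
  have -> : (2 * (8 * a + gamma1%:Z) + 1) ^+ 2 + (2 * (8 * b + gamma2%:Z)) ^+ 2 =
    1 + 4 * ((8 * a + gamma1%:Z) * (8 * a + gamma1%:Z + 1)) +
    4 * ((8 * b + gamma2%:Z - 1) * (8 * b + gamma2%:Z - 1 + 1) + (8 * b + gamma2%:Z)) by ring.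
  by rewrite hm hl; ring.
split; first by lia.
rewrite -signr_odd -[RHS]signr_odd !oddM; congr ((-1) ^+ (_ && _)); lia.
Qed.

Section PrimesInResidueClass.
Variables (alpha : nat) (rho gamma1 gamma2 d : nat) (X : nat -> gint -> gint).
Hypotheses (alpha_gt0 : (0 < alpha)%N) (alpha_odd : odd alpha).
Hypotheses (rho_le1 : (rho <= 1)%N) (halpha : (alpha%:Z = (-1) ^+ rho %[mod 4])%Z).
Hypothesis XP : forall q, prime q -> odd q -> quartic_character q (X q).

Lemma quartic_eq_alpha_char (t : gint) :
    gcong 16%:R t (2 * gamma1%:R + 1 + 2 * gamma2%:R * gi) ->
    prime (gint_norm t) ->
  quartic alpha%:R t = gi ^+ d <->
  alpha_char alpha X t = (-1) ^+ (rho * gamma2) * gi ^+ d.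
Proof.
move=> ht t_pr; have [t_odd t_sign] := sign_norm rho ht.
have t2 : (2 %| gim t)%Z by move/gcong16P: ht => [_ h]; lia.
rewrite (quartic_alpha alpha_gt0 alpha_odd XP rho_le1 halpha t_pr t_odd erefl t2) t_sign.
set e := (-1) ^+ (rho * gamma2).
have e2 : e * e = 1 by rewrite -expr2 /e -exprM mulnC exprM sqrrN !expr1n.
by split=> [<-|->]; rewrite mulrA e2 mul1r.
Qed.

End PrimesInResidueClass.

Theorem theorem4p5 (R : realType) (HL : hardy_littlewood R)
    (alpha rho : nat) (beta : gint) (r : int) (d gamma1 gamma2 : nat)
    (halpha_gt0 : (0 < alpha)%N) (halpha_odd : odd alpha)
    (hrho : (rho <= 1)%N) (halpha : (alpha%:Z = (-1) ^+ rho %[mod 4])%Z)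
    (hbeta : beta = 1 \/ beta = gi)
    (hr : r <> 0)
    (hd : (d <= 3)%N)
    (hgamma1 : (gamma1 <= 7)%N) (hgamma2 : (gamma2 <= 7)%N)
    (hgamma : gamma1 = gamma2 %[mod 2]) :
  asymp
    (fun x : R => (G_count d r alpha%:R beta gamma1 gamma2 x)%:R : R[i])
    ((h1 R r / 16)%:C * (Delta_G r beta gamma1 gamma2)%:R
       * G_const R d r alpha rho beta gamma2)
    (fun x : R => (Num.sqrt x / ln x)%:C).
Proof.
have /choice[X XP] : forall q, exists Xq, prime q -> odd q -> quartic_character q Xq.
  move=> q; have [q_pr|q_npr] := boolP (prime q); last by exists id.
  have [q_odd|q_even] := boolP (odd q); last by exists id.
  by have [Xq hX] := exists_quartic_character q_pr q_odd; exists Xq.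
(* When [Delta_G] is 0, the trace condition contradicts the congruence: the counted set is empty,
   and the O(1) reading applies. *)
have asymp0 : (forall (x : R) t, ~ G_set d r alpha%:R beta gamma1 gamma2 x t) ->
    Delta_G r beta gamma1 gamma2 = 0%N ->
  asymp
    (fun x : R => (G_count d r alpha%:R beta gamma1 gamma2 x)%:R : R[i])
    ((h1 R r / 16)%:C * (Delta_G r beta gamma1 gamma2)%:R
       * G_const R d r alpha rho beta gamma2)
    (fun x : R => (Num.sqrt x / ln x)%:C).
  move=> hA ->; rewrite mulr0 mul0r /asymp eqxx; exists 0; apply: nearW => x.
  rewrite /G_count (card_fset_set_seq (L := [::])) ?normr0 // => t.
  by split=> // /hA.
(* The common argument for both values of beta: pi = u(s + ni), [delta] = X_alpha(u), and c is the
   class of n modulo 16. *)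
have main (u delta : gint) (s c : int) :
    r = 2 * s -> ~~ (2 %| c + s)%Z -> u \in gunits ->
    delta \in gunits -> delta ^+ 2 = 1 ->
    delta * alpha_char alpha X gi = quartic (gi * beta) alpha%:R ->
    alpha_char alpha X u = delta ->
    Delta_G r beta gamma1 gamma2 = 1%N ->
    (forall t, gint_trace (beta * t) = r /\
       gcong 16%:R t (2 * gamma1%:R + 1 + 2 * gamma2%:R * gi) <->
       exists2 n : int, t = u * Gint s n & (16 %| n - c)%Z) ->
  asymp
    (fun x : R => (G_count d r alpha%:R beta gamma1 gamma2 x)%:R : R[i])
    ((h1 R r / 16)%:C * (Delta_G r beta gamma1 gamma2)%:R
       * G_const R d r alpha rho beta gamma2)
    (fun x : R => (Num.sqrt x / ln x)%:C).
  move=> rs cs uu du d2 hq hu -> ht.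
  have s0 : s != 0 by apply/eqP => s0; apply: hr; rewrite rs s0.
  set w := delta * ((-1) ^+ (rho * gamma2) * gi ^+ d).
  have sgu : (-1) ^+ (rho * gamma2) \in gunits.
    by rewrite -signr_odd; case: odd.
  have wu : w \in gunits by rewrite !gunitsM ?gi_expr_gunits.
  rewrite mulr1 rs -(block_constE R s rho gamma2 halpha_gt0 halpha_odd hd XP du d2 hq) -rs.
  have F_inj : injective (fun n : int => u * Gint s n).
    move=> m n /(congr1 (fun z => gconj u * z)).
    by rewrite !mulrA (mulrC (gconj u)) gunits_conj // !mul1r => -[].
  have -> : (fun x : R => (G_count d r alpha%:R beta gamma1 gamma2 x)%:R : R[i]) =
      (fun x : R => ((G_count d r alpha%:R beta gamma1 gamma2 x)%:R)%:C).
    by apply/funext => x; rewrite rmorph_nat.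
  apply: asymp_complex.
  apply: (asymp_signed_count HL halpha_gt0 halpha_odd s0 XP wu cs F_inj) => x t.
  have norm_t n : gint_norm (u * Gint s n) = (`|n| ^ 2 + `|s| ^ 2)%N.
    by move: uu; rewrite gunitsE gint_normM gint_norm_absz => /eqP->; rewrite mul1n.
  have char_t n : alpha_char alpha X (u * Gint s n) = (-1) ^+ (rho * gamma2) * gi ^+ d <->
      alpha_char alpha X (Gint s n) = w.
    rewrite (alpha_charM halpha_odd XP) hu /w; split=> [<-|->];
      by rewrite mulrA -expr2 d2 mul1r.
  split=> [[[t_pr tx] tr qt cg]|[n tE /andP[/andP[nc /eqP hw] /andP[n_pr nx]]]].
    have [n tE nc] := (ht t).1 (conj tr cg); exists n => //.
    have qt' := (quartic_eq_alpha_char d halpha_gt0 halpha_odd hrho halpha XP cg t_pr).1 qt.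
    rewrite /good_residue nc /good -(norm_t n) -tE t_pr tx /= andbT.
    by apply/eqP/char_t; rewrite -tE.
  have [tr cg] : gint_trace (beta * t) = r /\
      gcong 16%:R t (2 * gamma1%:R + 1 + 2 * gamma2%:R * gi) by apply/ht; exists n.
  have t_pr : prime (gint_norm t) by rewrite tE norm_t.
  split=> //; first by split; rewrite // tE norm_t.
  apply/(quartic_eq_alpha_char d halpha_gt0 halpha_odd hrho halpha XP cg t_pr).
  by rewrite tE; apply/char_t.
have T2 := sqr_alpha_char_gi halpha_gt0 halpha_odd XP.
case: hbeta main asymp0 => [->|->] main asymp0.
  have DE : Delta_G r 1 gamma1 gamma2 = if (32 %| r - (4 * gamma1%:Z + 2))%Z then 1%N else 0%N.
    by rewrite /Delta_G eqxx andbT (_ : (1 == gi) = false) // andbF eqz_mod_dvd.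
  have trE t : gint_trace (1 * t) = 2 * gre t.
    by rewrite mul1r /gint_trace !gintE; ring.
  move: DE; case: ifP => hD DE; last first.
    apply: asymp0 => // x t [_ tr _ /(gcong16P _ _ t)[h _]]; rewrite trE in tr.
    by move/negP: hD; apply; lia.
  have [s rs] : exists s, r = 2 * s by exists (r %/ 2)%Z; lia.
  (* Tr(pi) = 2 Re(pi), so pi = s + ni with n = Im(pi) = 2 gamma_2 mod 16. *)
  apply: (main 1 1 s (2 * gamma2%:Z)) => //; first by lia.
  - by rewrite mul1r mulr1 (quartic_gi_alpha halpha_gt0 halpha_odd XP).
  - by have := alpha_charX halpha_odd XP 1 0; rewrite expr0.
  move=> t; rewrite trE gcong16P; split.
    case=> tr [h1 h2]; exists (gim t) => //; rewrite mul1r.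
    by apply: gint_ext => //=; lia.
  by case=> n -> hn; rewrite mul1r /=; split; [lia|split; lia].
have DE : Delta_G r gi gamma1 gamma2 = if (32 %| r + 4 * gamma2%:Z)%Z then 1%N else 0%N.
  by rewrite /Delta_G eqxx andbT (_ : (gi == 1) = false) // andbF eqz_mod_dvd opprK.
have trE t : gint_trace (gi * t) = - (2 * gim t).
  by rewrite /gint_trace !gintE; ring.
move: DE; case: ifP => hD DE; last first.
  apply: asymp0 => // x t [_ tr _ /(gcong16P _ _ t)[_ h]]; rewrite trE in tr.
  by move/negP: hD; apply; lia.
have [s rs] : exists s, r = 2 * s by exists (r %/ 2)%Z; lia.
(* Tr(i pi) = -2 Im(pi), so pi = n - si = i^3 (s + ni) with n = Re(pi) = 2 gamma_1 + 1 mod 16. As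
   X_alpha(i)^2 = 1, X_alpha(i^3) = X_alpha(i), and its product with X_alpha(i) is 1, the symbol of
   i beta = -1. *)
apply: (main (gi ^+ 3) (alpha_char alpha X gi) s (2 * gamma1%:Z + 1)) => //; first by lia.
- by rewrite alpha_char_gi ?gi_expr_gunits.
- by rewrite -expr2 T2 (quartic_giN1_alpha halpha_gt0 halpha_odd XP).
- by rewrite (alpha_charX halpha_odd XP) exprS T2 mulr1.
have gi3 n : gi ^+ 3 * Gint s n = Gint n (- s).
  by rewrite exprS sqr_gi mulrN1; apply: gint_ext; rewrite !gintE /=; ring.
move=> t; rewrite trE gcong16P; split.
  case=> tr [h1 h2]; exists (gre t) => //; rewrite gi3.
  by apply: gint_ext => //=; lia.
by case=> n; rewrite gi3 => -> hn /=; split; [lia|split; lia].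
Qed.
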